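(* Let $n\in\mathbb{N}$ and let $f:\mathbb{R}\to\mathbb{R}$ be a locally Lipschitz function. Let $u\in C^{2}(\mathbb{R}^n)\cap L^\infty(\mathbb{R}^n)$ be a solution of $$\Delta u-\langle x,\nabla u\rangle+f(u)=0\quad\text{in }\mathbb{R}^n.$$ Assume that there exists $w\in\mathbb{R}^n$ such that $$\langle\nabla u(x),w\rangle>0\qquad\text{for any }x\in\mathbb{R}^n.$$ Then $u$ is one-dimensional, i.e. there exist $U:\mathbb{R}\to\mathbb{R}$ and $\omega\in\mathbb{R}^n$ such that $u(x)=U(\langle\omega,x\rangle)$ for any $x\in\mathbb{R}^n$.
   Context: $\langle\cdot,\cdot\rangle$ is the Euclidean inner product on $\mathbb{R}^n$; $\Delta$ and $\nabla$ are the usual Laplacian and gradient. *)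

(* Defs.v *)
From HB Require Import structures.
From mathcomp Require Import all_boot all_order all_algebra.
From mathcomp Require Import all_classical all_reals all_analysis.

Set Implicit Arguments.
Unset Strict Implicit.
Unset Printing Implicit Defensive.

Import Order.TTheory GRing.Theory Num.Theory.
Import numFieldNormedType.Exports.

Local Open Scope classical_set_scope.
Local Open Scope ring_scope.

Section EuclideanSpace.
Context {R : realType} {n : nat}.
Implicit Types (x y a b : 'rV[R]_n) (u : 'rV[R]_n -> R) (i : 'I_n).

Definition inner x y : R := \sum_i x 0 i * y 0 i.

Definition basis_vec i : 'rV[R]_n := delta_mx 0 i.

Definition partial i u : 'rV[R]_n -> R := fun x => 'D_(basis_vec i) u x.

Definition gradient u x : 'rV[R]_n := \row_i partial i u x.

Definition laplacian u x : R := \sum_i partial i (partial i u) x.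

Definition C1 u : Prop :=
  continuous u /\
  forall i, (forall x, derivable u x (basis_vec i)) /\ continuous (partial i u).

Definition C2 u : Prop := C1 u /\ forall i, C1 (partial i u).

Definition closed_box a b : set 'rV[R]_n :=
  [set x | forall i, a 0 i <= x 0 i <= b 0 i].

Definition box_volume a b : R := \prod_i (b 0 i - a 0 i).

(* Null sets of the n-dimensional Lebesgue measure, which the library only
   provides in dimension one. *)
Definition lebesgue_null (A : set 'rV[R]_n) : Prop :=
  forall e : R, 0 < e ->
  exists a b : nat -> 'rV[R]_n,
    [/\ forall k i, a k 0 i <= b k 0 i,
        A `<=` \bigcup_k closed_box (a k) (b k) &
        (\sum_(0 <= k <oo) (box_volume (a k) (b k))%:E <= e%:E)%E].

(* Measurability, the other half of membership in L^oo, is not required here: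
   the predicate is only meant for continuous functions. *)
Definition ess_bounded u : Prop :=
  exists M : R, lebesgue_null [set x | M < `|u x|].

End EuclideanSpace.

Definition locally_lipschitz {R : realType} (f : R -> R) : Prop :=
  forall t0 : R, exists2 e : R, 0 < e & [lipschitz f t | t in ball t0 e].

(* Main.v *)
(** For continuous [f], differentiating the equation in two directions [i], [k]
    and testing against [d_k u * psi] and [d_i u * psi] leaves, by subtraction,
    [\int (d_k u grad d_i u - d_i u grad d_k u) . grad psi dgamma = 0] for the
    Gaussian measure [gamma]: the terms in [f] add up to the integral of
    [d_k G d_i chi - d_i G d_k chi] with [G] a primitive of [f] composed with [u]
    and [chi] a compactly supported [C1] function, which vanishes. Summing
    against [w] yields [div (phi^2 gamma grad sigma) = 0] weakly, for
    [phi = <grad u, w>] positive and [sigma = d_i u / phi]. As [gamma] is finite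
    and [u], [f u] are bounded, [grad u] has finite weighted energy, so testing
    with [tau^3 sigma], [tau] a cutoff at scale [r], and letting [r] grow forces
    [sigma] to be constant. Hence [grad u] has a constant direction.

    Integrals are replaced by Riemann sums over a periodic grid in the cube
    [[-r, r]^n], so that "the integral vanishes" becomes "the sums tend to 0 with
    the mesh", and integration by parts becomes invariance under grid shifts. *)
Require Import Defs.
From mathcomp Require Import all_boot all_order all_algebra.
From mathcomp Require Import all_classical all_reals all_analysis.
From mathcomp Require Import ring lra.
Import Order.TTheory GRing.Theory Num.Theory.
Import numFieldNormedType.Exports.
Local Open Scope classical_set_scope.
Local Open Scope ring_scope.

Set Implicit Arguments.
Unset Strict Implicit.
Unset Printing Implicit Defensive.

(** * Partial derivatives *)

Section DirectionalMeanValue.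
Context {R : realType} {V : normedModType R}.
Implicit Types (u : V -> R) (x v : V).

Lemma is_derive_line u x v (t d : R) :
  is_derive (t *: v + x) v u d -> is_derive t 1 (fun s : R => u (s *: v + x)) d.
Proof.
have E : (fun h : R => h^-1 *: (((fun s => u (s *: v + x)) \o shift t) (h *: 1)
            - u (t *: v + x)))
       = (fun h => h^-1 *: ((u \o shift (t *: v + x)) (h *: v) - u (t *: v + x))).
  by apply/funext => h /=; rewrite addrA -scalerDl [h *: 1]mulr1.
move=> [du uE]; split; first by rewrite /derivable E.
by rewrite -uE /derive E.
Qed.

Lemma is_derive_shift u x v a (d : R) :
  is_derive (a + x) v u d -> is_derive x v (fun y => u (a + y)) d.
Proof.
have E : (fun h : R => h^-1 *: (((fun y => u (a + y)) \o shift x) (h *: v)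
            - u (a + x)))
       = (fun h => h^-1 *: ((u \o shift (a + x)) (h *: v) - u (a + x))).
  by apply/funext => h /=; rewrite addrCA.
move=> [du uE]; split; first by rewrite /derivable E.
by rewrite -uE /derive E.
Qed.

Lemma mean_value_direction u x v (h : R) : (forall y, derivable u y v) ->
  exists2 t : R, `|t| <= `|h| &
    u (h *: v + x) - u x = h * 'D_v u (t *: v + x).
Proof.
move=> du.
have dl (t : R) : is_derive t 1 (fun s : R => u (s *: v + x)) ('D_v u (t *: v + x)).
  by apply: is_derive_line; exact: derivableP.
have cl (A : set R) : {within A, continuous (fun s : R => u (s *: v + x))}.
  apply/continuous_subspaceT => t; apply/differentiable_continuous.
  by apply/derivable1_diffP; case: (dl t).
have [h0|h0] := leP 0 h.
  have [t] := MVT_segment h0 (fun t _ => dl t) (cl _).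
  rewrite in_itv /= scale0r add0r subr0 mulrC => /andP[t0 th] ->.
  by exists t => //; rewrite !ger0_norm.
have [t] := MVT_segment (ltW h0) (fun t _ => dl t) (cl _).
rewrite in_itv /= scale0r add0r sub0r => /andP[ht t0] E.
exists t; first by rewrite !ler0_norm ?lerN2 // ltW.
by apply: oppr_inj; rewrite opprB E mulrN mulrC.
Qed.

End DirectionalMeanValue.

(** * Continuous gradients and their calculus *)

Section Gradients.
Context {R : realType} {n : nat}.
Implicit Types (u v : 'rV[R]_n -> R) (du dv : 'I_n -> 'rV[R]_n -> R).
Implicit Types (x : 'rV[R]_n) (i j : 'I_n).

Let continuous_add u v : continuous u -> continuous v ->
  continuous (fun x => u x + v x).
Proof. by move=> cu cv x; apply: (@continuousD _ _ _ u v); [exact: cu|exact: cv]. Qed.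

Let continuous_mul u v : continuous u -> continuous v ->
  continuous (fun x => u x * v x).
Proof. by move=> cu cv x; apply: (@continuousM _ _ u v); [exact: cu|exact: cv]. Qed.

(** The partial derivatives form an explicit family [du], so that the rules below yield formulas
    that [ring] can compare. *)
Definition has_gradient u du := continuous u /\
  forall i, (forall x, is_derive x (basis_vec i) u (du i x)) /\
            continuous (du i).

Lemma C1_has_gradient u : C1 u -> has_gradient u (fun i => partial i u).
Proof.
by move=> [cu du]; split=> // i; have [? ?] := du i; split=> // x; exact: derivableP.
Qed.

Lemma has_gradient_cst (c : R) : has_gradient (fun=> c) (fun _ _ => 0).
Proof.
split=> [|i]; first exact: cst_continuous.
by split=> [x|]; [exact: is_derive_cst|exact: cst_continuous].
Qed.

Lemma has_gradientD u du v dv : has_gradient u du -> has_gradient v dv ->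
  has_gradient (fun x => u x + v x) (fun i x => du i x + dv i x).
Proof.
move=> [cu Du] [cv Dv]; split; first exact: continuous_add.
move=> i; have [dui cui] := Du i; have [dvi cvi] := Dv i; split=> [x|].
  exact: is_deriveD.
exact: continuous_add.
Qed.

Lemma has_gradientM u du v dv : has_gradient u du -> has_gradient v dv ->
  has_gradient (fun x => u x * v x) (fun i x => du i x * v x + u x * dv i x).
Proof.
move=> [cu Du] [cv Dv]; split; first exact: continuous_mul.
move=> i; have [dui cui] := Du i; have [dvi cvi] := Dv i; split=> [x|].
  have D := is_deriveM (dui x) (dvi x); apply: (is_derive_eq D).
  by rewrite addrC [_ *: du i x]mulrC.
by apply: continuous_add; apply: continuous_mul.
Qed.

Lemma has_gradient_sum (I : Type) (s : seq I) (F : I -> 'rV[R]_n -> R) dF :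
  (forall k, has_gradient (F k) (dF k)) ->
  has_gradient (fun x => \sum_(k <- s) F k x)
    (fun i x => \sum_(k <- s) dF k i x).
Proof.
move=> HF; elim: s => [|k s IH].
  rewrite (_ : (fun x => _) = fun=> 0); last by apply/funext => x; rewrite big_nil.
  rewrite (_ : (fun i x => _) = fun _ _ => 0); last first.
    by apply/funext => i; apply/funext => x; rewrite big_nil.
  exact: has_gradient_cst.
rewrite (_ : (fun x => _) = fun x => F k x + \sum_(k <- s) F k x); last first.
  by apply/funext => x; rewrite big_cons.
rewrite (_ : (fun i x => _) = fun i x => dF k i x + \sum_(k <- s) dF k i x).
  exact: has_gradientD.
by apply/funext => i; apply/funext => x; rewrite big_cons.
Qed.

(** [p] is constrained only at values of [u], since the primitive of [f] is built to have derivative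
    [f] only on a bounded interval. Restriction to a coordinate line reduces the claim to the
    one-variable chain rule. *)
Lemma has_gradient_comp (p dp : R -> R) u du :
  (forall x, is_derive (u x) 1 p (dp (u x))) ->
  (forall x, {for u x, continuous dp}) -> has_gradient u du ->
  has_gradient (p \o u) (fun i x => dp (u x) * du i x).
Proof.
move=> Dp cdp [cu Du]; split.
  move=> x; apply: continuous_comp; first exact: cu.
  apply/differentiable_continuous/derivable1_diffP.
  by have [] := Dp x.
move=> i; have [dui cui] := Du i; split=> [x|]; last first.
  apply: continuous_mul => // x.
  by apply: continuous_comp; [exact: cu|exact: cdp].
have line : is_derive (0 : R) 1 (fun s => u (s *: basis_vec i + x)) (du i x).
  by apply: is_derive_line; rewrite scale0r add0r.
have Dl : is_derive (0 : R) 1 (p \o (fun s => u (s *: basis_vec i + x)))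
    (dp (u x) * du i x).
  by apply: is_derive1_comp; rewrite /= scale0r add0r.
have E : (fun h : R => h^-1 *: (((p \o u) \o shift x) (h *: basis_vec i) - (p \o u) x))
   = (fun h : R => h^-1 *: (((p \o (fun s => u (s *: basis_vec i + x))) \o shift 0)
          (h *: 1) - (p \o (fun s => u (s *: basis_vec i + x))) 0)).
  by apply/funext => h /=; rewrite scale0r add0r addr0 [h *: 1]mulr1.
case: Dl => ex val; split; first by rewrite /derivable E.
by rewrite -val /derive E.
Qed.

Lemma has_gradient_coord j :
  has_gradient (fun x => x 0 j) (fun i _ => (i == j)%:R).
Proof.
split; first exact: coord_continuous.
move=> i; split => [x|x]; last exact: cst_continuous.
have E : (fun h : R => h^-1 *: (((fun x : 'rV[R]_n => x 0 j) \o shift x)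
           (h *: basis_vec i) - x 0 j)) = fun h => h^-1 * (h * (i == j)%:R).
  by apply/funext => h /=; rewrite !mxE eqxx andTb addrK eq_sym.
have L : h^-1 * (h * (i == j)%:R) @[h --> (0 : R)^'] --> ((i == j)%:R : R).
  apply: cvg_near_cst; near=> h; rewrite mulKf //.
  by near: h; exact: nbhs_dnbhs_neq.
by split; [apply/cvg_ex; exists (i == j)%:R; rewrite E
          | rewrite /derive E; exact: cvg_lim].
Unshelve. all: by end_near. Qed.

Lemma has_gradientZ (c : R) u du : has_gradient u du ->
  has_gradient (fun x => c * u x) (fun i x => c * du i x).
Proof.
move=> Hu; have := has_gradientM (has_gradient_cst c) Hu.
rewrite (_ : (fun i x => 0 * u x + c * du i x) = fun i x => c * du i x) //.
by apply/funext => i; apply/funext => x; rewrite mul0r add0r.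
Qed.

Lemma has_gradientV u du : (forall x, u x != 0) -> has_gradient u du ->
  has_gradient (fun x => (u x)^-1) (fun i x => - (u x) ^- 2 * du i x).
Proof.
move=> u0 Hu.
apply: (@has_gradient_comp (fun t => t^-1) (fun t => - t ^- 2)) => // x.
  by have := @is_deriveV R id (u x) 1 1 (u0 x) _; rewrite [_ *: 1]mulr1; apply.
apply: (@continuousN _ _ _ (fun t : R => t ^- 2)).
apply: (@continuousV _ _ (fun t : R => t ^+ 2)); first by rewrite expf_neq0.
exact: exprn_continuous.
Qed.

Lemma has_gradient_eq u du u' du' : has_gradient u du ->
  u =1 u' -> (forall i, du i =1 du' i) -> has_gradient u' du'.
Proof.
move=> Hu /funext <- E; rewrite (_ : du' = du) //.
by apply/funext => i; apply/funext => x; rewrite E.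
Qed.

(* The second difference of [u] over a small parallelogram is, up to the factor
   [h^2], a value near [x] of either mixed partial. *)
Lemma partial_sym u i j x : C2 u ->
  partial i (partial j u) x = partial j (partial i u) x.
Proof.
move=> [C1u C1du].
have [cu Du] := C1_has_gradient C1u.
have D2 k := C1_has_gradient (C1du k).
have key k l (h : R) : exists s t : R, [/\ `|s| <= `|h|, `|t| <= `|h| &
    u (h *: basis_vec k + (h *: basis_vec l + x))
    - u (h *: basis_vec k + x) - u (h *: basis_vec l + x) + u x
    = h * (h * partial k (partial l u) (s *: basis_vec k + (t *: basis_vec l + x)))].
  (* The second difference is the increment of [q] in direction [l]; a second mean value step then
     acts on [partial l u] in direction [k]. *)
  pose q := fun y : 'rV[R]_n => u (h *: basis_vec k + y) - u y.
  have Dq (y : 'rV[R]_n) : is_derive y (basis_vec l) q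
      (partial l u (h *: basis_vec k + y) - partial l u y).
    apply: (@is_deriveB _ _ _ (fun y => u (h *: basis_vec k + y)) u).
      by apply: is_derive_shift; have [+ _] := Du l; apply.
    by have [+ _] := Du l; apply.
  have [t th Et] := @mean_value_direction _ _ q x (basis_vec l) h
    (fun y => @ex_derive _ _ _ _ _ _ _ (Dq y)).
  have [s sh Es] := @mean_value_direction _ _ (partial l u)
    (t *: basis_vec l + x) (basis_vec k) h
    (fun y => @ex_derive _ _ _ _ _ _ _ (((D2 l).2 k).1 y)).
  exists s, t; split => //.
  move: Et; rewrite (@derive_val _ _ _ _ _ _ _ (Dq _)) Es /q => <-.
  by ring.
apply/eqP/negPn/negP => neq.
pose a := partial i (partial j u) x; pose b := partial j (partial i u) x.
have e0 : 0 < `|a - b| / 2 by rewrite divr_gt0 ?normr_gt0 ?subr_eq0.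
have near_x k l : \forall y \near x,
    `|partial k (partial l u) x - partial k (partial l u) y| < `|a - b| / 2.
  have /cvgrPdist_lt := ((D2 l).2 k).2 x; exact.
have : nbhs x [set y | `|partial i (partial j u) x - partial i (partial j u) y| < `|a - b| / 2
  /\ `|partial j (partial i u) x - partial j (partial i u) y| < `|a - b| / 2].
  exact: filterI (near_x i j) (near_x j i).
move=> /nbhs_ballP[d d0 dP].
pose N : R := 1 + (`|basis_vec i : 'rV[R]_n| + `|basis_vec j : 'rV[R]_n|).
have N0 : 0 < N by rewrite ltr_wpDr.
pose h := d / N.
have h0 : 0 < h by rewrite divr_gt0.
have ballx k l (s t : R) : (k, l) \in [:: (i, j); (j, i)] -> `|s| <= `|h| -> `|t| <= `|h| ->
    ball x d (s *: basis_vec k + (t *: basis_vec l + x)).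
  move=> kl sh th; rewrite -ball_normE /ball_ /= distrC addrA addrK.
  apply: (le_lt_trans (ler_normD _ _)); rewrite !normrZ.
  have : `|s| * `|basis_vec k : 'rV[R]_n| + `|t| * `|basis_vec l : 'rV[R]_n| <=
     h * (`|basis_vec i : 'rV[R]_n| + `|basis_vec j : 'rV[R]_n|).
    rewrite -[X in _ <= X * _](ger0_norm (ltW h0)).
    have -> : `|basis_vec i : 'rV[R]_n| + `|basis_vec j : 'rV[R]_n| =
      `|basis_vec k : 'rV[R]_n| + `|basis_vec l : 'rV[R]_n|.
      by move: kl; rewrite !inE => /orP[] /eqP[-> ->] //; rewrite addrC.
    by rewrite mulrDr lerD // ler_wpM2r.
  move/le_lt_trans; apply.
  rewrite /h -mulrA gtr_pMr // mulrC ltr_pdivrMr // mul1r /N.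
  by rewrite ltrDr.
have [s1 [t1 [s1h t1h E1]]] := key i j h.
have [s2 [t2 [s2h t2h E2]]] := key j i h.
have : h * (h * partial i (partial j u) (s1 *: basis_vec i + (t1 *: basis_vec j + x)))
   = h * (h * partial j (partial i u) (s2 *: basis_vec j + (t2 *: basis_vec i + x))).
  have swap (y1 y2 y3 y4 : R) : y1 - y2 - y3 + y4 = y1 - y3 - y2 + y4 by ring.
  apply: (etrans (esym E1)); apply: etrans E2; apply: (etrans (swap _ _ _ _)).
  by rewrite [X in u X - _]addrCA.
move/(mulfI (lt0r_neq0 h0))/(mulfI (lt0r_neq0 h0)) => E.
have [A _] := dP _ (ballx i j s1 t1 (mem_head _ _) s1h t1h).
have ji : (j, i) \in [:: (i, j); (j, i)] by rewrite !inE eqxx orbT.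
have [_ B] := dP _ (ballx j i s2 t2 ji s2h t2h).
rewrite E -/a in A; rewrite -/b in B.
move: e0 A B; move: (partial j (partial i u) (_ + _)) a b {neq near_x dP} => c a b _ A B.
have := ler_distD c a b; rewrite [X in _ <= _ + X]distrC leNgt => /negP; apply.
by rewrite [ltRHS]splitr ltrD.
Qed.

(** The path from [x] to [a + x] changes one coordinate at a time, [p m] having the first [m] of
    them moved; each leg is one mean value step. *)
Lemma mean_value_coordinates u du x (a : 'rV[R]_n) : has_gradient u du ->
  exists2 xi : 'I_n -> 'rV[R]_n,
    forall i j, `|xi i 0 j - x 0 j| <= `|a 0 j| &
    u (a + x) - u x = \sum_i a 0 i * du i (xi i).
Proof.
move=> [_ Du].
pose p (m : nat) : 'rV[R]_n := (\row_(j < n) if (j < m)%N then a 0 j else 0) + x.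
have step (i : 'I_n) : {t : R | `|t| <= `|a 0 i| &
    u (p i.+1) - u (p i) = a 0 i * du i (t *: basis_vec i + p i)}.
  apply: cid2.
  have [t tv E] := @mean_value_direction _ _ u (p i) (basis_vec i) (a 0 i)
    (fun y => @ex_derive _ _ _ _ _ _ _ ((Du i).1 y)).
  exists t => //; rewrite -(@derive_val _ _ _ _ _ _ _ ((Du i).1 _)) -E.
  congr (u _ - _); rewrite /p addrA; congr (_ + x).
  apply/rowP => j; rewrite !mxE eqxx /= ltnS leq_eqVlt.
  have [->|ne] := eqVneq j i; first by rewrite eqxx ltnn mulr1 addr0.
  by rewrite val_eqE (negbTE ne) mulr0 add0r.
exists (fun i => s2val (step i) *: basis_vec i + p i) => [i j|].
  case: (step i) => t /= tv _; rewrite !mxE eqxx /= addrA addrK.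
  have [->|ne] := eqVneq j i; first by rewrite ltnn mulr1 addr0.
  by rewrite mulr0 add0r; case: ifP => // _; rewrite normr0.
rewrite (eq_bigr (fun i : 'I_n => u (p i.+1) - u (p i))); last first.
  by move=> i _; case: (step i).
rewrite -(big_mkord xpredT (fun m => u (p m.+1) - u (p m))) telescope_sumr //.
congr (u _ - u _); apply/rowP => j; rewrite !mxE; last by rewrite add0r.
by rewrite ltn_ord.
Qed.

(** The derivative along the line [t *: a + x] is the vanishing sum; it is computed from increments
    in the coordinate directions, where the derivatives are given. *)
Lemma constant_of_orthogonal_gradient u du x (a : 'rV[R]_n) : has_gradient u du ->
  (forall y, \sum_i a 0 i * du i y = 0) -> u (a + x) = u x.
Proof.
move=> Hu ortho.
have D (s : R) : is_derive s 1 (fun t : R => u (t *: a + x)) 0.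
  pose y := s *: a + x.
  have L : (fun h : R => h^-1 *: (((fun t : R => u (t *: a + x)) \o shift s) (h *: 1)
            - u (s *: a + x))) @ 0^' --> (0 : R).
    apply/cvgrPdist_le => e e0.
    (* [K] is positive and bounds each coordinate of [a], so [|h| < d / K] keeps all intermediate
       points in the ball. *)
    pose K : R := 1 + \sum_i `|a 0 i|.
    have K0 : 0 < K by rewrite ltr_wpDr // sumr_ge0.
    have : nbhs y [set z | forall i, `|du i y - du i z| <= e / K].
      have near_y i : \forall z \near y, `|du i y - du i z| <= e / K.
        by have /cvgrPdist_le := (Hu.2 i).2 y; apply; exact: divr_gt0.
      exact: filter_forall near_y.
    move=> /nbhs_ballP[d d0 dP].
    have dK : 0 < d / K by rewrite divr_gt0.
    near=> h.
    have h0 : h != 0 by near: h; exact: nbhs_dnbhs_neq.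
    have hd : `|h| < d / K by near: h; exact: dnbhs0_lt.
    rewrite /= sub0r normrN [h *: 1]mulr1 scalerDl -addrA.
    have [xi xiP ->] := mean_value_coordinates y (h *: a) Hu.
    (* Subtracting the vanishing sum at [y] leaves only increments of [du i], small by
       continuity. *)
    have -> : h^-1 *: (\sum_i (h *: a) 0 i * du i (xi i)) =
        \sum_i a 0 i * (du i (xi i) - du i y).
      under [in RHS]eq_bigr do rewrite mulrBr.
      rewrite sumrB ortho subr0 [_ *: _]mulr_sumr; apply: eq_bigr => i _.
      by rewrite mxE -mulrA mulKf.
    apply: (le_trans (ler_norm_sum _ _ _)).
    have xi_ball i : ball y d (xi i).
      split => // i' j; rewrite ord1 /ball /= distrC.
      apply: (le_lt_trans (xiP i j)); rewrite mxE normrM.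
      have aK : `|a 0 j| <= K.
        by rewrite /K (bigD1 j) //= addrCA lerDl addr_ge0 // sumr_ge0.
      apply: (@le_lt_trans _ _ (`|h| * K)); first by rewrite ler_wpM2l.
      by rewrite -ltr_pdivlMr.
    apply: (@le_trans _ _ (\sum_i `|a 0 i| * (e / K))).
      apply: ler_sum => i _; rewrite normrM ler_wpM2l // distrC.
      exact: (dP _ (xi_ball i)).
    rewrite -mulr_suml mulrCA -[leRHS]mulr1 ler_pM2l //.
    by rewrite ler_pdivrMr // mul1r /K lerDr.
  split; first by apply/cvg_ex; exists 0.
  exact: cvg_lim L.
by have := is_derive_0_is_cst 1 0 D; rewrite scale1r scale0r add0r.
Unshelve. all: by end_near. Qed.

End Gradients.

(** * Sums over a periodic grid *)

Section GridSums.
Context {R : realType} {n : nat}.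
Implicit Types (r : R) (m : nat) (g : 'rV[R]_n -> R) (i j : 'I_n).

Definition mesh r m : R := r *+ 2 / m.+1%:R.

(** Indices stop at [m]: the faces at [- r] carry nodes and those at [r] do not, so the grid closes
    up cyclically. *)
Definition node r m (k : {ffun 'I_n -> 'I_m.+1}) : 'rV[R]_n :=
  \row_j (mesh r m * (k j)%:R - r).

Definition grid_sum r m g : R := mesh r m ^+ n * \sum_k g (@node r m k).

(** Stands for the vanishing of the integral of [g] over the cube [[-r, r]^n]. *)
Definition grid_null r g := grid_sum r ^~ g @ \oo --> (0 : R).

Definition vanishes_outside r g :=
  forall (x : 'rV[R]_n) i, r <= `|x 0 i| -> g x = 0.

Lemma mesh_gt0 r m : 0 < r -> 0 < mesh r m.
Proof. by move=> r0; rewrite divr_gt0 ?mulrn_wgt0. Qed.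

Lemma mesh_lt r (d : R) : 0 < d -> \forall m \near \oo, mesh r m < d.
Proof.
move=> d0.
have K0 : 0 < 1 + `|r *+ 2| by rewrite ltr_wpDr.
have dK : 0 < d / (1 + `|r *+ 2|) by rewrite divr_gt0.
near=> m.
have : m.+1%:R^-1 < d / (1 + `|r *+ 2|).
  by near: m; exact: (near_infty_natSinv_lt (PosNum dK)).
rewrite ltr_pdivlMr // mulrC => /(le_lt_trans _); apply; rewrite /mesh.
by rewrite ler_wpM2r // (le_trans (ler_norm _)) // lerDr.
Unshelve. all: by end_near. Qed.

Lemma node_in r m (k : {ffun 'I_n -> 'I_m.+1}) j : 0 < r ->
  - r <= node r k 0 j <= r.
Proof.
move=> r0; rewrite mxE; have h0 := mesh_gt0 m r0.
have hm : mesh r m * m.+1%:R = r *+ 2 by rewrite divfK.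
have : mesh r m * (k j)%:R <= mesh r m * m.+1%:R.
  by rewrite ler_pM2l // ler_nat ltnW.
have : 0 <= mesh r m * (k j)%:R by rewrite mulr_ge0 // ltW.
rewrite hm mulr2n; lra.
Qed.

Lemma grid_sum_le r m g g' : 0 < r ->
  (forall x : 'rV[R]_n, (forall i, `|x 0 i| <= r) -> g x <= g' x) ->
  grid_sum r m g <= grid_sum r m g'.
Proof.
move=> r0 le; apply: ler_wpM2l; first by rewrite exprn_ge0 // ltW // mesh_gt0.
by apply: ler_sum => k _; apply: le => i; rewrite ler_norml node_in.
Qed.

Lemma grid_sumD r m g g' : grid_sum r m (fun x => g x + g' x) = grid_sum r m g + grid_sum r m g'.
Proof. by rewrite /grid_sum big_split mulrDr. Qed.

Lemma grid_sumZ r m (c : R) g : grid_sum r m (fun x => c * g x) = c * grid_sum r m g.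
Proof. by rewrite /grid_sum -mulr_sumr mulrCA. Qed.

Lemma grid_sumB r m g g' : grid_sum r m (fun x => g x - g' x) = grid_sum r m g - grid_sum r m g'.
Proof. by rewrite /grid_sum sumrB mulrBr. Qed.

Lemma grid_sum_sum r m (I : Type) (s : seq I) (F : I -> 'rV[R]_n -> R) :
  grid_sum r m (fun x => \sum_(a <- s) F a x) = \sum_(a <- s) grid_sum r m (F a).
Proof. by rewrite /grid_sum exchange_big mulr_sumr. Qed.

Lemma grid_sum_prod r m (F : 'I_n -> R -> R) :
  grid_sum r m (fun x => \prod_i F i (x 0 i)) =
  \prod_i (mesh r m * \sum_(k < m.+1) F i (mesh r m * k%:R - r)).
Proof.
rewrite big_split /= prodr_const card_ord; congr (_ * _).
rewrite bigA_distr_bigA /=; apply: eq_bigr => k _.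
by apply: eq_bigr => i _; rewrite mxE.
Qed.

Lemma grid_sum_cst r m (c : R) : grid_sum r m (fun=> c) = (r *+ 2) ^+ n * c.
Proof.
rewrite /grid_sum sumr_const card_ffun !card_ord -mulr_natr natrX mulrCA -exprMn.
by rewrite divfK // mulrC.
Qed.

(* The grid is shifted cyclically; indices that wrap around only meet faces of
   the cube, where [g] vanishes. *)
Lemma grid_sum_shift r m i g : vanishes_outside r g ->
  grid_sum r m (fun x => g (mesh r m *: basis_vec i + x)) = grid_sum r m g.
Proof.
move=> gr; congr (_ * _).
pose s (k : {ffun 'I_n -> 'I_m.+1}) : {ffun 'I_n -> 'I_m.+1} :=
  [ffun j => if j == i then ordS (k j) else k j].
pose s' (k : {ffun 'I_n -> 'I_m.+1}) : {ffun 'I_n -> 'I_m.+1} :=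
  [ffun j => if j == i then ord_pred (k j) else k j].
have sK : cancel s s'.
  by move=> k; apply/ffunP => j; rewrite !ffunE; case: eqP => // _; rewrite ordSK.
have s'K : cancel s' s.
  by move=> k; apply/ffunP => j; rewrite !ffunE; case: eqP => // _; rewrite ord_predK.
rewrite [RHS](reindex s); last by exists s' => k _.
apply: eq_bigr => k _.
have hm : mesh r m * m.+1%:R = r *+ 2 by rewrite divfK.
have [km|km] := ltnP (k i) m.
  congr g; apply/rowP => j; rewrite !mxE eqxx /= ffunE.
  have [->|_] := eqVneq j i; last by rewrite mulr0 add0r.
  by rewrite /= modn_small // mulr1 -natr1; ring.
(* At the last index the shift lands on the face at [r] and its cyclic replacement on the face at
   [- r]; [g] vanishes on both. *)
have {}km : k i = m :> nat by apply/eqP; rewrite eqn_leq km -ltnS ltn_ord.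
rewrite !(gr _ i) //; rewrite !mxE ?ffunE !eqxx /= km.
  by rewrite modnn mulr0 sub0r normrN ler_norm.
have -> : mesh r m * 1 + (mesh r m * m%:R - r) = r.
  by apply: (@addIr _ r); rewrite -mulr2n -hm -natr1; ring.
exact: ler_norm.
Qed.

(** [gm m] is a discretization whose sum vanishes exactly; a uniform error changes the sum by at
    most that error times the volume of the cube. *)
Lemma null_approx r g (gm : nat -> 'rV[R]_n -> R) : 0 < r ->
  (forall m, grid_sum r m (gm m) = 0) ->
  (forall e, 0 < e -> \forall m \near \oo, forall x : 'rV[R]_n,
     (forall i, `|x 0 i| <= r) -> `|g x - gm m x| <= e) ->
  grid_null r g.
Proof.
move=> r0 gm0 close; apply/cvgrPdist_le => e e0.
have K0 : 0 < (r *+ 2) ^+ n by rewrite exprn_gt0 // mulrn_wgt0.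
have := close _ (divr_gt0 e0 K0); apply: filterS => m le.
have eE : (r *+ 2) ^+ n * (e / (r *+ 2) ^+ n) = e by rewrite mulrC divfK // gt_eqF.
rewrite sub0r normrN -[grid_sum r m g]subr0 -(gm0 m) -grid_sumB ler_norml -eE -mulrN.
rewrite -!(@grid_sum_cst r m); apply/andP; split; apply: grid_sum_le => // x xr;
  by have := le x xr; rewrite ler_norml => /andP[].
Qed.

Lemma null_ext r g g' : g =1 g' -> grid_null r g -> grid_null r g'.
Proof. by move=> /funext ->. Qed.

Lemma nullD r g g' : grid_null r g -> grid_null r g' -> grid_null r (fun x => g x + g' x).
Proof.
move=> N N'; rewrite /grid_null (_ : grid_sum r ^~ _ = fun m => grid_sum r m g + grid_sum r m g').
  by rewrite -[0]addr0; exact: cvgD.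
by apply/funext => m; rewrite grid_sumD.
Qed.

Lemma nullZ r (c : R) g : grid_null r g -> grid_null r (fun x => c * g x).
Proof.
move=> N; rewrite /grid_null (_ : grid_sum r ^~ _ = fun m => c * grid_sum r m g).
  by rewrite -[0](mulr0 c); exact: cvgM (cvg_cst c) N.
by apply/funext => m; rewrite grid_sumZ.
Qed.

Lemma nullB r g g' : grid_null r g -> grid_null r g' -> grid_null r (fun x => g x - g' x).
Proof.
move=> N /(nullZ (-1)) /(nullD N); apply: null_ext => x; by rewrite mulN1r.
Qed.

Lemma null_sum r (I : Type) (s : seq I) (F : I -> 'rV[R]_n -> R) :
  (forall a, grid_null r (F a)) -> grid_null r (fun x => \sum_(a <- s) F a x).
Proof.
move=> HF; elim: s => [|a s IH].
  apply: (@null_ext _ (fun=> 0)) => [x|]; first by rewrite big_nil.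
  rewrite /grid_null (_ : grid_sum r ^~ _ = fun=> 0); first exact: cvg_cst.
  by apply/funext => m; rewrite grid_sum_cst mulr0.
by apply: null_ext (nullD (HF a) IH) => x; rewrite big_cons.
Qed.

(** * Compactness of cubes and discrete integration by parts *)

Lemma closed_box_compact (a b : 'rV[R]_n) : compact (closed_box a b).
Proof.
rewrite (_ : closed_box a b =
    [set x | forall i, `[a 0 i, b 0 i]%classic (x ord0 i)]).
  by apply: (@rV_compact _ _ (fun i => `[a 0 i, b 0 i]%classic)) => i; exact: segment_compact.
by apply/seteqP; split => x /= H i; have := H i; rewrite in_itv.
Qed.

Lemma cube_compact r : compact [set x : 'rV[R]_n | forall i, `|x 0 i| <= r].
Proof.
rewrite (_ : mkset _ = closed_box (const_mx (- r)) (const_mx r)).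
  exact: closed_box_compact.
by apply/seteqP; split => x /= H i; have := H i; rewrite !mxE ler_norml.
Qed.

(** The displacements [y] and [z] are independent because the mean value theorem gives each factor
    its own intermediate point. Compactness of the cube makes [d] uniform in [x]. *)
Lemma uniform_continuity_mul r (p q : 'rV[R]_n -> R) (e : R) :
  continuous p -> continuous q -> 0 < e ->
  exists2 d : R, 0 < d & forall x y z : 'rV[R]_n,
    (forall i, `|x 0 i| <= r) ->
    (forall i, `|y 0 i| < d) -> (forall i, `|z 0 i| < d) ->
    `|p x * q x - p (y + x) * q (z + x)| <= e.
Proof.
move=> cp cq e0.
have /compact_near_coveringP cov := @cube_compact r.
have := cov ('rV[R]_n * 'rV[R]_n)%type (nbhs (0 : 'rV[R]_n, 0 : 'rV[R]_n))
  (fun w x => `|p x * q x - p (w.1 + x) * q (w.2 + x)| <= e).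
case=> [x xr|D [D1 D2] DP].
  pose F := nbhs (x, (0 : 'rV[R]_n, 0 : 'rV[R]_n)).
  have L1 : z.2.1 + z.1 @[z --> F] --> x.
    rewrite -[X in _ --> X]add0r; apply: cvgD; last exact: cvg_fst.
    by apply: cvg_comp; [exact: cvg_snd|exact: cvg_fst].
  have L2 : z.2.2 + z.1 @[z --> F] --> x.
    rewrite -[X in _ --> X]add0r; apply: cvgD; last exact: cvg_fst.
    by apply: cvg_comp; [exact: cvg_snd|exact: cvg_snd].
  have L : p z.1 * q z.1 - p (z.2.1 + z.1) * q (z.2.2 + z.1) @[z --> F] --> 0.
    rewrite -(subrr (p x * q x)); apply: cvgB; apply: cvgM.
    - by apply: cvg_comp; [exact: cvg_fst|exact: cp].
    - by apply: cvg_comp; [exact: cvg_fst|exact: cq].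
    - by apply: cvg_comp; [exact: L1|exact: cp].
    - by apply: cvg_comp; [exact: L2|exact: cq].
  move/cvgrPdist_le : L => /(_ e e0); apply: filterS => -[x' w] /=.
  by rewrite sub0r normrN.
move/nbhs_ballP: D1 => [d1 d10 B1]; move/nbhs_ballP: D2 => [d2 d20 B2].
have in_ball (d d' : R) (y : 'rV[R]_n) : 0 < d -> d' <= d ->
    (forall i, `|y 0 i| < d') -> ball (0 : 'rV[R]_n) d y.
  move=> d0 d'd yd; split => // i j.
  by rewrite ord1 mxE /ball /= sub0r normrN (lt_le_trans (yd j)).
exists (Num.min d1 d2); first by rewrite lt_min d10.
move=> x y z xr yd zd; apply: (DP (y, z)) => //.
by split => /=; [apply: B1|apply: B2]; [apply: in_ball yd|apply: in_ball zd] => //;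
  rewrite ge_min lexx ?orbT.
Qed.

Lemma difference_quotient_close r i j (G X : 'rV[R]_n -> R) dG dX : 0 < r ->
  has_gradient G dG -> has_gradient X dX ->
  forall e, 0 < e -> \forall m \near \oo, forall x : 'rV[R]_n,
     (forall k, `|x 0 k| <= r) ->
  `|dG j x * dX i x - mesh r m ^- 2 *
    ((G (mesh r m *: basis_vec j + (mesh r m *: basis_vec i + x))
       - G (mesh r m *: basis_vec i + x))
     * (X (mesh r m *: basis_vec i + x) - X x))| <= e.
Proof.
move=> r0 [cG DG] [cX DX] e e0.
have [d d0 H] := @uniform_continuity_mul r _ _ e (DG j).2 (DX i).2 e0.
(* The point for [G] is displaced along both [i] and [j], hence by up to two meshes. *)
have d20 : 0 < d / 2 by rewrite divr_gt0.
apply: filterS (mesh_lt r d20) => m hd x xr.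
set a := mesh r m *: basis_vec i.
have h0 : 0 < mesh r m := mesh_gt0 m r0.
have [t th ->] := @mean_value_direction _ _ G (a + x) (basis_vec j) (mesh r m)
  (fun y => @ex_derive _ _ _ _ _ _ _ ((DG j).1 y)).
have [s sh ->] := @mean_value_direction _ _ X x (basis_vec i) (mesh r m)
  (fun y => @ex_derive _ _ _ _ _ _ _ ((DX i).1 y)).
rewrite (@derive_val _ _ _ _ _ _ _ ((DG j).1 _)) (@derive_val _ _ _ _ _ _ _ ((DX i).1 _)).
rewrite mulrACA -expr2 mulKf ?expf_neq0 ?gt_eqF // addrA.
move: th sh; rewrite [`|mesh r m|]gtr0_norm // => th sh.
have small (c : R) k l : `|c| <= mesh r m -> `|(c *: (basis_vec k : 'rV[R]_n)) 0 l| <= mesh r m.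
  rewrite !mxE eqxx /= normrM; case: eqP => _; first by rewrite normr1 mulr1.
  by rewrite normr0 mulr0 => _; exact: ltW.
apply: H => // k.
  rewrite mxE (le_lt_trans (ler_normD _ _)) //.
  rewrite [ltRHS]splitr ltrD // (le_lt_trans (small _ _ _ _)) //.
  by rewrite gtr0_norm.
by rewrite (le_lt_trans (small _ _ _ sh)) // (lt_trans hd) // ltr_pdivrMr // ltr_pMr // ltr1n.
Qed.

(** With the coordinate [x 0 i] as [G], one factor of the product of differences is exactly the
    mesh; the other is an increment of [X], whose sum is zero by shift invariance. *)
Lemma null_partial r i (X : 'rV[R]_n -> R) dX : 0 < r ->
  has_gradient X dX -> vanishes_outside r X -> grid_null r (dX i).
Proof.
move=> r0 HX Xr.
pose G (x : 'rV[R]_n) := x 0 i.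
apply: (null_approx (gm := fun m x => mesh r m ^- 2 *
   ((G (mesh r m *: basis_vec i + (mesh r m *: basis_vec i + x))
       - G (mesh r m *: basis_vec i + x))
     * (X (mesh r m *: basis_vec i + x) - X x)))) => // [m|e e0].
  transitivity (grid_sum r m (fun x => mesh r m ^- 2 * (mesh r m *
      (X (mesh r m *: basis_vec i + x) - X x)))).
    congr grid_sum; apply/funext => x; congr (_ * (_ * _)).
    by rewrite /G mxE addrK !mxE !eqxx mulr1.
  by rewrite !grid_sumZ grid_sumB grid_sum_shift // subrr !mulr0.
have := difference_quotient_close i i r0 (has_gradient_coord i) HX e0.
apply: filterS => m close x xr; have := close x xr; rewrite /= eqxx mul1r; exact.
Qed.

(* Formally both terms integrate to [- \int X d_i d_j G]; on the grid this only
   needs the second differences of [G] to be symmetric, so [C1] suffices. *)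
Lemma null_curl r i j (G X : 'rV[R]_n -> R) dG dX : 0 < r ->
  has_gradient G dG -> has_gradient X dX -> vanishes_outside r X ->
  grid_null r (fun x => dG j x * dX i x - dG i x * dX j x).
Proof.
move=> r0 HG HX Xr.
pose D m k l x := (G (mesh r m *: basis_vec l + (mesh r m *: basis_vec k + x))
       - G (mesh r m *: basis_vec k + x)) * (X (mesh r m *: basis_vec k + x) - X x).
(* Moving the shifted [X] back by one mesh turns [D] into [S], where [X] multiplies minus the second
   difference of [G], symmetric in [k] and [l]. *)
pose S m k l x := X x * (G (mesh r m *: basis_vec l + x) - G x
   - (G (mesh r m *: basis_vec l + (mesh r m *: basis_vec k + x))
       - G (mesh r m *: basis_vec k + x))).
have DS m k l : grid_sum r m (D m k l) = grid_sum r m (S m k l).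
  pose T x := X x * (G (mesh r m *: basis_vec l + x) - G x).
  have Tr : vanishes_outside r T.
    by move=> x c xc; rewrite /T (Xr x c xc) mul0r.
  transitivity (grid_sum r m (fun x => T (mesh r m *: basis_vec k + x) -
     X x * (G (mesh r m *: basis_vec l + (mesh r m *: basis_vec k + x))
       - G (mesh r m *: basis_vec k + x)))).
    by congr grid_sum; apply/funext => x; rewrite /D /T mulrBr mulrC [X in _ - X]mulrC.
  rewrite grid_sumB grid_sum_shift // -grid_sumB; congr grid_sum; apply/funext => x.
  by rewrite /T /S -mulrBr.
apply: (null_approx (gm := fun m x => mesh r m ^- 2 * (D m i j x - D m j i x))) => //.
  move=> m; rewrite grid_sumZ grid_sumB !DS (_ : S m i j = S m j i) ?subrr ?mulr0 //.
  apply/funext => x; rewrite /S addrCA; congr (_ * _); ring.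
move=> e e0; have e20 : 0 < e / 2 by exact: divr_gt0.
have C1 := difference_quotient_close i j r0 HG HX e20.
have C2 := difference_quotient_close j i r0 HG HX e20.
apply: filterS2 C1 C2 => m C1 C2 x xr; rewrite mulrBr.
apply: (le_trans _ (_ : e / 2 + e / 2 <= e)); last by rewrite -splitr.
apply: (le_trans _ (lerD (C1 x xr) (C2 x xr))).
apply: (le_trans _ (ler_normB _ _)); rewrite -/(D m i j x) -/(D m j i x).
by rewrite opprD opprK addrACA opprD opprK.
Qed.

End GridSums.

(** * Counting grid points in boxes *)

Section Counting.
Context {R : realType}.

Let clamp (lo hi t : R) := Num.max lo (Num.min t hi).

Let clamp_telescope (lo hi h r : R) N :
  \sum_(k < N) (clamp lo hi (h * k%:R - r + h) - clamp lo hi (h * k%:R - r)) =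
  clamp lo hi (h * N%:R - r) - clamp lo hi (- r).
Proof.
rewrite (eq_bigr (fun k : 'I_N =>
    clamp lo hi (h * k.+1%:R - r) - clamp lo hi (h * k%:R - r))).
  rewrite -(big_mkord xpredT
    (fun k => clamp lo hi (h * k.+1%:R - r) - clamp lo hi (h * k%:R - r))).
  by rewrite telescope_sumr // mulr0 sub0r.
by move=> k _; rewrite -natr1 mulrDr mulr1 addrAC.
Qed.

Let clamp_cases (lo hi t : R) : lo <= hi ->
  [\/ t <= lo /\ clamp lo hi t = lo, lo <= t <= hi /\ clamp lo hi t = t
     | hi <= t /\ clamp lo hi t = hi].
Proof.
rewrite /clamp => lohi; case: (leP t hi) => th; last first.
  by constructor 3; rewrite (max_r lohi) ltW.
case: (leP lo t) => lt; last by constructor 1; rewrite ltW.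
by constructor 2; rewrite ?th ?lt.
Qed.

(** From [t] to [t + h] the truncation to [[a, b + h]] grows by exactly [h] when [t] is in [[a, b]],
    and it never decreases; the telescoped total bounds the count. *)
Lemma grid_count_le (a b h r : R) N : 0 < h -> a <= b ->
  h * (\sum_(k < N) (a <= h * k%:R - r <= b)%R%:R) <= b - a + h.
Proof.
move=> h0 ab; have ab' : a <= b + h by lra.
rewrite mulr_sumr.
apply: (@le_trans _ _ (clamp a (b + h) (h * N%:R - r) - clamp a (b + h) (- r))).
  rewrite -clamp_telescope; apply: ler_sum => k _; move: (h * k%:R - r) => t.
  case: (clamp_cases t ab') => -[t1 ->]; case: (clamp_cases (t + h) ab') => -[t2 ->];
    case: (boolP (a <= t <= b)) => [/andP[ta tb]|tab]; rewrite ?mulr1 ?mulr0; lra.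
by case: (clamp_cases (- r) ab') => -[? ->];
  case: (clamp_cases (h * N%:R - r) ab') => -[? ->]; lra.
Qed.

(** From [t] to [t + h] the truncation to [[a + h, b]] grows by at most [h], and not at all unless
    [t] is in [[a, b]]; its total increment is [b - a - h]. *)
Lemma grid_count_ge (a b h r : R) N : 0 < h -> h <= b - a ->
  - r <= a -> b <= h * N%:R - r ->
  b - a - h <= h * (\sum_(k < N) (a <= h * k%:R - r <= b)%R%:R).
Proof.
move=> h0 hab ra br; have ab' : a + h <= b by lra.
rewrite mulr_sumr.
apply: (@le_trans _ _ (clamp (a + h) b (h * N%:R - r) - clamp (a + h) b (- r))).
  by case: (clamp_cases (- r) ab') => -[? ->];
    case: (clamp_cases (h * N%:R - r) ab') => -[? ->]; lra.
rewrite -clamp_telescope; apply: ler_sum => k _; move: (h * k%:R - r) => t.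
by case: (clamp_cases t ab') => -[t1 ->]; case: (clamp_cases (t + h) ab') => -[t2 ->];
  case: (boolP (a <= t <= b)) => [_|]; rewrite ?mulr1 ?mulr0 ?negb_and -?ltNge;
  try (move/orP => [tab|tab]); lra.
Qed.

(** * Grid sums over boxes, and null sets *)

Context {n : nat}.
Implicit Types a b x : 'rV[R]_n.

(** The product form makes the grid sum factor into one-dimensional counts. *)
Definition box_indicator a b x : R :=
  \prod_(i < n) (a 0 i <= x 0 i <= b 0 i)%R%:R.

Lemma box_indicator_ge0 a b x : 0 <= box_indicator a b x.
Proof. exact: prodr_ge0. Qed.

Lemma box_indicator_in a b x : closed_box a b x -> box_indicator a b x = 1.
Proof. by move=> xab; rewrite /box_indicator big1 // => i _; rewrite xab. Qed.

Lemma box_indicator_out a b x : ~ closed_box a b x -> box_indicator a b x = 0.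
Proof.
move=> xab; apply/eqP/prodf_eq0; apply: contrapT => H; apply: xab => i.
by apply: contrapT => /negP/negbTE Hi; apply: H; exists i => //; rewrite Hi.
Qed.

Lemma grid_sum_box_le r m a b : 0 < r -> (forall i, a 0 i <= b 0 i) ->
  grid_sum r m (box_indicator a b) <= \prod_i (b 0 i - a 0 i + mesh r m).
Proof.
move=> r0 ab; rewrite [grid_sum _ _ _](grid_sum_prod r m (fun i t => (a 0 i <= t <= b 0 i)%R%:R)).
apply: ler_prod => i _.
rewrite grid_count_le ?mesh_gt0 // andbT mulr_ge0 ?sumr_ge0 //.
exact/ltW/mesh_gt0.
Qed.

Lemma grid_sum_box_ge r m a b : 0 < r -> (forall i, mesh r m <= b 0 i - a 0 i) ->
  (forall i, - r <= a 0 i) -> (forall i, b 0 i <= r) ->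
  \prod_i (b 0 i - a 0 i - mesh r m) <= grid_sum r m (box_indicator a b).
Proof.
move=> r0 hab ra br.
rewrite [grid_sum _ _ _](grid_sum_prod r m (fun i t => (a 0 i <= t <= b 0 i)%R%:R)).
apply: ler_prod => i _.
rewrite subr_ge0 hab /= grid_count_ge ?mesh_gt0 //.
by rewrite divfK // mulr2n addrK.
Qed.

(* After a slight enlargement of the covering boxes, compactness leaves finitely
   many of them, whose volumes are compared by counting grid points. *)
Lemma lebesgue_null_cube (x : 'rV[R]_n) (s : R) (A : set 'rV[R]_n) : 0 < s ->
  closed_box (x - const_mx s) (x + const_mx s) `<=` A -> ~ lebesgue_null A.
Proof.
move=> s0 cubeA nullA.
(* The cover will cost [e] for its volume and [e] for its enlargement, in all half of the lower
   bound [s ^+ n]. *)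
pose e := s ^+ n / 4; have e0 : 0 < e by rewrite divr_gt0 ?exprn_gt0.
have [a [b [ab Acov vol_le]]] := nullA e e0.
(* [3 * d] accounts for [d] at either end of a side and for one mesh lost in counting. *)
have enlarge k : exists2 d : R, 0 < d &
    \prod_i (b k 0 i - a k 0 i + 3 * d) <= box_volume (a k) (b k) + e / 2 ^+ k.+1.
  have ek : 0 < e / 2 ^+ k.+1 by rewrite divr_gt0 ?exprn_gt0.
  have C (l : seq 'I_n) : \prod_(i <- l) (b k 0 i - a k 0 i + 3 * d) @[d --> (0 : R)]
      --> \prod_(i <- l) (b k 0 i - a k 0 i).
    elim: l => [|i l IH].
      by rewrite big_nil; under eq_fun do rewrite big_nil; exact: cvg_cst.
    rewrite big_cons; under eq_fun do rewrite big_cons.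
    apply: cvgM => //; rewrite -[X in _ --> X]addr0; apply: cvgD; first exact: cvg_cst.
    by rewrite -[X in _ --> X](mulr0 3); apply: cvgM; [exact: cvg_cst|exact: cvg_id].
  have /cvgrPdist_le /(_ _ ek) /nbhs_ballP[d d0 dP] := C (index_enum _).
  exists (d / 2); first by rewrite divr_gt0.
  have : ball 0 d (d / 2).
    rewrite /ball /= sub0r normrN gtr0_norm ?divr_gt0 //.
    by rewrite ltr_pdivrMr // ltr_pMr // ltr1n.
  by move/dP; rewrite /= distrC /box_volume ler_distl => /andP[].
have [d dP] : exists d : nat -> R, forall k, 0 < d k /\
    \prod_i (b k 0 i - a k 0 i + 3 * d k) <= box_volume (a k) (b k) + e / 2 ^+ k.+1.
  by exists (fun k => s2val (cid2 (enlarge k))) => k; case: cid2.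
have /compact_near_coveringP cov := @closed_box_compact _ _ (x - const_mx s) (x + const_mx s).
have [N] : exists N, forall y, closed_box (x - const_mx s) (x + const_mx s) y ->
    exists2 k : nat, (k < N)%N &
      forall i, a k 0 i - d k < y 0 i < b k 0 i + d k.
  have : \forall N \near \oo, closed_box (x - const_mx s) (x + const_mx s) `<=`
     [set y | exists2 k : nat, (k < N)%N &
      forall i, a k 0 i - d k < y 0 i < b k 0 i + d k].
    apply: (cov nat \oo (fun N y => exists2 k : nat, (k < N)%N &
      forall i, a k 0 i - d k < y 0 i < b k 0 i + d k)) => y yx.
    have [k _ yk] := Acov _ (cubeA _ yx); have [dk0 _] := dP k.
    exists (ball y (d k), [set N | (k < N)%N]).
      by split; [exact: nbhsx_ballx|exists k.+1].
    move=> [z N] /= [[_ yz] kN]; exists k => // i.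
    have := yz 0 i; have /andP[] := yk i.
    rewrite /ball /= ltr_norml; move: (z 0 i) (y 0 i) (a k 0 i) (b k 0 i) (d k).
    by move=> z1 y1 a1 b1 d1; lra.
  by case=> N _ /(_ N (leqnn N)) NP; exists N.
move=> NP.
pose r := 1 + s + \sum_i `|x 0 i|.
have r0 : 0 < r by rewrite /r -addrA ltr_pwDl // addr_ge0 ?sumr_ge0 // ltW.
have xr i : `|x 0 i| + s <= r.
  rewrite /r (bigD1 i) //=.
  have : 0 <= \sum_(j < n | j != i) `|x 0 j| by rewrite sumr_ge0.
  lra.
have [m [ms md]] : exists m, mesh r m < s /\ forall k : 'I_N, mesh r m < d k.
  have near_d : \forall m \near \oo, forall k : 'I_N, mesh r m < d k.
    by apply: filter_forall => k; apply: mesh_lt; have [] := dP k.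
  have [M _ MP] := filterI (mesh_lt r s0) near_d.
  by exists M; exact: MP (leqnn M).
have lower : s ^+ n <= grid_sum r m (box_indicator (x - const_mx s) (x + const_mx s)).
  apply: (le_trans _ (grid_sum_box_ge r0 _ _ _)).
  - rewrite -[X in s ^+ X](card_ord n) -prodr_const; apply: ler_prod => i _.
    by rewrite !mxE ltW //=; lra.
  - by move=> i; rewrite !mxE; lra.
  - by move=> i; rewrite !mxE; have := xr i; have := ler_norm (- x 0 i); rewrite normrN; lra.
  - by move=> i; rewrite !mxE; have := xr i; have := ler_norm (x 0 i); lra.
pose A' k := a k - const_mx (d k); pose B' k := b k + const_mx (d k).
have upper : grid_sum r m (box_indicator (x - const_mx s) (x + const_mx s)) <=
    \sum_(k < N) grid_sum r m (box_indicator (A' k) (B' k)).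
  rewrite -grid_sum_sum; apply: grid_sum_le => // y _.
  have [yx|yx] := pselect (closed_box (x - const_mx s) (x + const_mx s) y); last first.
    by rewrite box_indicator_out // sumr_ge0 // => k _; exact: box_indicator_ge0.
  have [k kN yk] := NP y yx; rewrite box_indicator_in //.
  rewrite (bigD1 (Ordinal kN)) //= box_indicator_in.
    by rewrite lerDl sumr_ge0 // => l _; exact: box_indicator_ge0.
  by move=> i; rewrite !mxE; have /andP[/ltW -> /ltW ->] := yk i.
have each (k : 'I_N) : grid_sum r m (box_indicator (A' k) (B' k)) <=
    box_volume (a k) (b k) + e / 2 ^+ k.+1.
  have [dk0 dk] := dP k; apply: le_trans dk.
  apply: (le_trans (grid_sum_box_le _ r0 _)).
    by move=> i; rewrite !mxE; have := ab k i; lra.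
  apply: ler_prod => i _; rewrite !mxE.
  by have := ab k i; have := md k; have := mesh_gt0 m r0; lra.
have geom : \sum_(k < N) e / 2 ^+ k.+1 <= e.
  suff -> : \sum_(k < N) e / 2 ^+ k.+1 = e - e / 2 ^+ N.
    by rewrite gerBl divr_ge0 ?exprn_ge0 // ltW.
  elim: (N) => [|M IH]; first by rewrite big_ord0 expr0 divr1 subrr.
  by rewrite big_ord_recr /= IH exprS; field; rewrite expf_neq0.
have vol : \sum_(k < N) box_volume (a k) (b k) <= e.
  rewrite -lee_fin -sumEFin; apply: le_trans vol_le.
  rewrite -(big_mkord xpredT (fun k => (box_volume (a k) (b k))%:E)).
  apply: nneseries_lim_ge => k _ _; rewrite lee_fin prodr_ge0 // => i _.
  by rewrite subr_ge0.
have := le_trans lower (le_trans upper (ler_sum _ (fun k _ => each k))).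
rewrite big_split /= => /le_trans /(_ (lerD vol geom)).
have : 0 < s ^+ n by rewrite exprn_gt0.
rewrite /e; move: (s ^+ n) => S; lra.
Qed.

(** By continuity the set where [|u|] exceeds the essential bound is open; if nonempty it would
    contain a cube, which is not null. *)
Lemma ess_bounded_continuous (u : 'rV[R]_n -> R) : continuous u ->
  ess_bounded u -> exists M : R, forall x, `|u x| <= M.
Proof.
move=> cu [M uM]; exists M => x; rewrite leNgt; apply/negP => Mx; move: uM.
have : nbhs x [set y | M < `|u y|].
  have : `|u y| @[y --> x] --> `|u x| by exact: (cvg_norm (cu x)).
  by move=> /cvgr_gt; apply.
move=> /nbhs_ballP[d d0 dP]; apply: (@lebesgue_null_cube x (d / 2)) => [|y yx].
  by rewrite divr_gt0.
apply: dP; split => // i j; rewrite ord1.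
have := yx j; rewrite !mxE => /andP[? ?].
rewrite /ball /= ltr_norml; have : 0 < d := d0; lra.
Qed.

End Counting.

(** * Gaussian weight and cutoff *)

Section RealFunctions.
Context {R : realType}.

Lemma is_derive_quadratic_error (f : R -> R) (t d : R) :
  (forall h, `|f (h + t) - f t - h * d| <= h ^+ 2) -> is_derive t 1 f d.
Proof.
move=> fd.
have L : (fun h : R => h^-1 *: ((f \o shift t) (h *: 1) - f t)) @ 0^' --> d.
  apply/cvgrPdist_le => e e0; near=> h.
  have h0 : h != 0 by near: h; exact: nbhs_dnbhs_neq.
  have he : `|h| < e by near: h; exact: dnbhs0_lt.
  rewrite /= [h *: 1]mulr1 distrC.
  have -> : h^-1 *: (f (h + t) - f t) - d = h^-1 * (f (h + t) - f t - h * d).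
    by rewrite [RHS]mulrBr mulKf.
  rewrite normrM normfV ler_pdivrMl ?normr_gt0 //.
  apply: (le_trans (fd h)); rewrite -real_normK ?num_real // expr2.
  by rewrite ler_wpM2l // ltW.
by split; [apply/cvg_ex; exists d|exact: cvg_lim L].
Unshelve. all: by end_near. Qed.

(** Squaring removes the kink at [0], which is what makes the cutoff continuously differentiable. *)
Lemma is_derive_sqr_pos_part (t : R) :
  is_derive t 1 (fun s => Num.max 0 s ^+ 2) (2 * Num.max 0 t).
Proof.
apply: is_derive_quadratic_error => h.
case: (leP 0 (h + t)) => ht; case: (leP 0 t) => t0; rewrite ler_norml;
  apply/andP; split; nra.
Qed.

Lemma continuous_pos_part (t : R) : {for t, continuous (fun s : R => Num.max 0 s)}.
Proof. by apply: continuous_max; [exact: cst_continuous|exact: cvg_id]. Qed.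

Lemma locally_lipschitz_continuous (f : R -> R) :
  locally_lipschitz f -> continuous f.
Proof.
move=> fL t; have [d d0 lip] := fL t; apply/cvgrPdist_le => e e0.
have [K [K0 HK]] : exists K : R, 0 < K /\
    forall s, ball t d s -> `|f t - f s| <= K * `|t - s|.
  have [K [_ HK]] := lip.
  exists (1 + `|K|); split; first by rewrite ltr_pwDl.
  have /HK H : K < 1 + `|K| by rewrite ltr_pwDl // ler_norm.
  by move=> s ts; apply: (H (t, s)); split => //=; exact: ballxx.
near=> s.
have /HK /le_trans : ball t d s by near: s; have := nbhsx_ballx t d d0; exact.
apply; rewrite -ler_pdivlMl // mulrC; near: s.
have /cvgrPdist_le := @cvg_id _ (nbhs t); apply; exact: divr_gt0.
Unshelve. all: by end_near. Qed.

Lemma bounded_antiderivative (f : R -> R) (M : R) : continuous f ->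
  exists F : R -> R, forall t : R, `|t| <= M -> is_derive t 1 F (f t).
Proof.
move=> cf.
(* Starting at [- M - 1] puts all of [[- M, M]] strictly inside the interval of integrability, as
   the fundamental theorem requires. *)
exists (fun t => (\int[lebesgue_measure]_(s in `[(- M - 1)%R, t]) f s)%R).
move=> t; rewrite ler_norml => /andP[tM1 tM2].
have tu : t < M + 1 by lra.
have int : lebesgue_measure.-integrable `[- M - 1, M + 1] (EFin \o f).
  apply: continuous_compact_integrable; first exact: segment_compact.
  exact: continuous_subspaceT.
have at' : - M - 1 < t by lra.
have [D E] := continuous_FTC1_closed tu int at' (cf t).
split; first exact: D.
by rewrite -derive1E; exact: E.
Qed.

Lemma continuous_bounded_on_segment (f : R -> R) (M : R) : continuous f ->
  exists B : R, forall t : R, `|t| <= M -> `|f t| <= B.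
Proof.
move=> cf.
have [M0|M0] := leP 0 M; last first.
  by exists 0 => t /le_lt_trans /(_ M0); rewrite normr_lt0.
have cf' : {within `[- M, M], continuous (fun t => `|f t|)}.
  by apply: continuous_subspaceT => t; exact: (cvg_norm (cf t)).
have MM : - M <= M by lra.
have [c _ cmax] := EVT_max MM cf'.
by exists `|f c| => t; rewrite ler_norml => tM; apply: cmax; rewrite in_itv.
Qed.

End RealFunctions.

(** * Gradients of the weight and of the cutoff *)

Section Weights.
Context {R : realType} {n : nat}.
Implicit Types (x : 'rV[R]_n) (r : R) (i j : 'I_n).

Definition sqnorm x : R := \sum_j x 0 j * x 0 j.

Lemma sqnorm_ge0 x : 0 <= sqnorm x.
Proof. by apply: sumr_ge0 => j _; rewrite -expr2 sqr_ge0. Qed.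

Lemma sqr_coord_le x j : x 0 j ^+ 2 <= sqnorm x.
Proof.
rewrite /sqnorm (bigD1 j) //= -expr2 lerDl sumr_ge0 // => k _.
by rewrite -expr2 sqr_ge0.
Qed.

Lemma has_gradient_sqnorm : has_gradient sqnorm (fun i x => 2 * x 0 i).
Proof.
have H := has_gradient_sum (index_enum 'I_n)
  (fun j => has_gradientM (@has_gradient_coord R n j) (has_gradient_coord j)).
apply: has_gradient_eq H _ _ => // i x /=.
rewrite (bigD1 i) //= big1 => [|j ji]; first by rewrite eqxx mul1r mulr1 addr0 mulr_natl.
by rewrite eq_sym (negbTE ji) mul0r mulr0 addr0.
Qed.

(** This weight absorbs the drift: the divergence of [gauss * grad u] is [gauss] times
    [laplacian u - <x, grad u>]. *)
Definition gauss x : R := expR (- 2^-1 * sqnorm x).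

Lemma gauss_gt0 x : 0 < gauss x. Proof. exact: expR_gt0. Qed.

Lemma gauss_le1 x : gauss x <= 1.
Proof.
rewrite -expR0 ler_expR mulNr oppr_le0 mulr_ge0 //; exact: sqnorm_ge0.
Qed.

Lemma has_gradient_gauss : has_gradient gauss (fun i x => - x 0 i * gauss x).
Proof.
have H := has_gradientZ (- 2^-1) has_gradient_sqnorm.
have {}H := has_gradient_comp (fun x => is_derive_expR _) (fun x => @continuous_expR R _) H.
apply: has_gradient_eq H _ _ => // i x /=.
by rewrite /gauss mulrC; congr (_ * _); field.
Qed.

Definition hat r x : R := Num.max 0 (1 - r ^- 2 * sqnorm x).
Definition cutoff r x : R := hat r x ^+ 2.

Lemma has_gradient_cutoff r :
  has_gradient (cutoff r) (fun i x => - 4 * r ^- 2 * hat r x * x 0 i).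
Proof.
have H := has_gradientD (has_gradient_cst 1) (has_gradientZ (- r ^- 2) has_gradient_sqnorm).
have {}H : has_gradient (fun x => 1 - r ^- 2 * sqnorm x)
    (fun i x => - (r ^- 2 * (2 * x 0 i))).
  by apply: has_gradient_eq H _ _ => [x|i x]; rewrite ?add0r mulNr.
have c2 (t : R) : {for t, continuous (fun s : R => 2 * Num.max 0 s)}.
  by apply: cvgM; [exact: cvg_cst|exact: continuous_pos_part].
have {}H := @has_gradient_comp R n (fun s => Num.max 0 s ^+ 2) (fun s => 2 * Num.max 0 s)
  _ _ (fun x => is_derive_sqr_pos_part _) (fun x => c2 _) H.
by apply: has_gradient_eq H _ _ => // i x; rewrite /hat /=; ring.
Qed.

Lemma cutoff_ge0 r x : 0 <= cutoff r x. Proof. exact: sqr_ge0. Qed.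

Lemma hat_le1 r x : 0 <= hat r x <= 1.
Proof.
rewrite /hat le_max lexx ge_max ler01 /= gerBl mulr_ge0 ?sqnorm_ge0 //.
by rewrite invr_ge0 sqr_ge0.
Qed.

Lemma cutoff_le1 r x : cutoff r x <= 1.
Proof. by rewrite /cutoff; have /andP[] := hat_le1 r x; nra. Qed.

Lemma cutoff_vanishes r : 0 < r -> vanishes_outside r (cutoff r).
Proof.
move=> r0 x i rx; rewrite /cutoff /hat max_l ?expr0n // subr_le0.
rewrite mulrC ler_pdivlMr ?exprn_gt0 // mul1r (le_trans _ (sqr_coord_le x i)) //.
by rewrite -[leRHS]real_normK ?num_real // ler_sqr ?nnegrE // ltW.
Qed.

(** The left side equals [16 * r ^- 2 * cutoff r x] times [|x|^2 / r^2], and [|x| <= r] wherever the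
    cutoff is nonzero. The remaining factor [cutoff r x] keeps the errors in the energy estimates
    localized. *)
Lemma sum_sqr_gradient_cutoff r x : 0 < r ->
  \sum_i (- 4 * r ^- 2 * hat r x * x 0 i) ^+ 2 <= 16 * r ^- 2 * cutoff r x.
Proof.
move=> r0.
have -> : \sum_i (- 4 * r ^- 2 * hat r x * x 0 i) ^+ 2 =
    16 * r ^- 2 * (cutoff r x * (r ^- 2 * sqnorm x)).
  rewrite /sqnorm /cutoff !mulr_sumr; apply: eq_bigr => i _; ring.
have s0 := sqnorm_ge0 x; have ri : 0 < r ^- 2 by rewrite invr_gt0 exprn_gt0.
apply: ler_wpM2l; first by rewrite mulr_ge0 // ltW.
rewrite /cutoff /hat.
case: (leP 0 (1 - r ^- 2 * sqnorm x)) => h; last by rewrite expr0n mul0r.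
apply: ler_piMr; first exact: sqr_ge0.
by rewrite -subr_ge0.
Qed.

End Weights.

(** * Weak equations and energy estimates *)

Section VanishesOutside.
Context {R : realType} {n : nat}.

Lemma vanishes_outsideMl (r : R) (g h : 'rV[R]_n -> R) :
  vanishes_outside r g -> vanishes_outside r (fun x => g x * h x).
Proof. by move=> gr x i rx; rewrite (gr x i rx) mul0r. Qed.

Lemma vanishes_outsideMr (r : R) (g h : 'rV[R]_n -> R) :
  vanishes_outside r h -> vanishes_outside r (fun x => g x * h x).
Proof. by move=> hr x i rx; rewrite (hr x i rx) mulr0. Qed.

End VanishesOutside.

(* [p] and [H] are the gradient and the Hessian of [u]; unification is very slow
   when they are spelled out with [partial]. *)
Section OrnsteinUhlenbeck.
Context {R : realType} {n : nat}.
Variables (f : R -> R) (u : 'rV[R]_n -> R).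
Variables (p : 'I_n -> 'rV[R]_n -> R) (H : 'I_n -> 'I_n -> 'rV[R]_n -> R).
Hypothesis Hu : has_gradient u p.
Hypothesis Hp : forall i, has_gradient (p i) (H i).
Hypothesis H_sym : forall i j x, H i j x = H j i x.
Hypothesis u_sol : forall x, f (u x) = \sum_j (x 0 j * p j x - H j j x).
Implicit Types (i j k : 'I_n) (x : 'rV[R]_n).

(* Testing against [p k * psi] in direction [i], minus the same with [i] and [k]
   exchanged; the terms in [f] form a curl of [F \o u], so [f'] never appears. *)
Lemma linearized_equation (F : R -> R) r i k psi dpsi : continuous f ->
  (forall x, is_derive (u x) 1 F (f (u x))) -> 0 < r ->
  has_gradient psi dpsi -> vanishes_outside r psi ->
  grid_null r (fun x => gauss x * \sum_j
    (p k x * H i j x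
     - p i x * H k j x) * dpsi j x).
Proof.
move=> f_cont F_f r0 Hpsi psir.
have Hchi := has_gradientM Hpsi (@has_gradient_gauss R n).
have chir : vanishes_outside r (fun x => psi x * gauss x)
  by exact: vanishes_outsideMl.
have HF := has_gradient_comp F_f (fun x => f_cont (u x)) Hu.
have N3 := null_curl i k r0 HF Hchi chir.
(* Weak form of the equation differentiated in direction [b], tested against [p a * psi * gauss]:
   the curl exchanges the derivatives in [j] and [b], and the last group is a full derivative in
   direction [b]. *)
have key a b : grid_null r (fun x => \sum_j
   ((H j j x * (H a b x * (psi x * gauss x) +
      p a x * (dpsi b x * gauss x + psi x * (- x 0 b * gauss x)))
    - H j b x * (H a j x * (psi x * gauss x) +
      p a x * (dpsi j x * gauss x + psi x * (- x 0 j * gauss x))))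
   - (((b == j)%:R * p j x + x 0 j * H j b x)
        * (p a x * (psi x * gauss x))
      + x 0 j * p j x * (H a b x * (psi x * gauss x) +
      p a x * (dpsi b x * gauss x + psi x * (- x 0 b * gauss x)))))).
  have Ha := has_gradientM (Hp a) Hchi.
  have ar : vanishes_outside r (fun x => p a x * (psi x * gauss x)).
    exact: vanishes_outsideMr.
  apply: null_sum => j; apply: nullB; first exact: (null_curl b j r0 (Hp j) Ha ar).
  have HX := has_gradientM (has_gradientM (has_gradient_coord j) (Hp j)) Ha.
  apply: (null_partial b r0 HX); exact: vanishes_outsideMr.
apply: null_ext (nullB (nullB (key i k) (key k i)) N3) => x /=.
rewrite u_sol -2!mulrA -mulrBr mulr_suml -!sumrB mulr_sumr.
set g := gauss x; set q := psi x.
(* The deltas come from differentiating the coordinate [x 0 j]; once summed they leave [p i * p k]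
   twice with opposite signs. *)
transitivity (\sum_j (g * ((p k x * H i j x
     - p i x * H k j x) * dpsi j x)
   + ((i == j)%:R * (p j x * p k x * (q * g))
      - (k == j)%:R * (p j x * p i x * (q * g))))).
  apply: eq_bigr => j _.
  rewrite (H_sym i k x) (H_sym i j x) (H_sym k j x).
  move: (p j x) (p i x) (p k x) (H j j x)
    (H i k x) (H i j x) (H k j x)
    (dpsi i x) (dpsi j x) (dpsi k x) (x 0 i) (x 0 j) (x 0 k) ((i == j)%:R) ((k == j)%:R).
  by move=> *; ring.
rewrite big_split /= sumrB -[RHS]addr0; congr (_ + _); apply/eqP.
rewrite subr_eq0; apply/eqP.
have pick a (Y : 'I_n -> R) : \sum_j (a == j)%:R * Y j = Y a.
  rewrite (bigD1 a) //= eqxx mul1r big1 ?addr0 // => j.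
  by rewrite eq_sym => /negbTE ->; rewrite mul0r.
by rewrite !pick [p i x * _]mulrC.
Qed.

(* The null part is twice the divergence of [u tau^2 gauss grad u]. *)
Lemma energy_estimate (r M B : R) : 1 <= r ->
  (forall x, `|u x| <= M) -> (forall x, `|f (u x)| <= B) ->
  exists2 N, grid_null r N & forall x,
    cutoff r x ^+ 2 * gauss x * \sum_i p i x ^+ 2 <=
    N x + (2 * M * B + 64 * M ^+ 2) * (cutoff r x * gauss x).
Proof.
move=> r1 uM fB; have r0 : 0 < r by rewrite (lt_le_trans ltr01).
pose tau := cutoff r : 'rV[R]_n -> R.
pose dtau i (x : 'rV[R]_n) := - 4 * r ^- 2 * hat r x * x 0 i.
have Htau : has_gradient tau dtau := has_gradient_cutoff r.
have HW := has_gradientM (has_gradientM Htau Htau) (@has_gradient_gauss R n).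
have Wr : vanishes_outside r (fun x => tau x * tau x * gauss x).
  by apply: vanishes_outsideMl; apply: vanishes_outsideMl; exact: cutoff_vanishes.
have NW i := null_partial i r0 (has_gradientM (has_gradientM Hu (Hp i)) HW)
  (vanishes_outsideMr (fun x => u x * p i x) Wr).
refine (ex_intro2 _ _ _ (nullZ 2 (null_sum (index_enum _) NW)) _) => x /=.
have g0 := gauss_gt0 x; set g := gauss x in g0 *.
have t0 : 0 <= tau x := cutoff_ge0 r x; have t1 : tau x <= 1 := cutoff_le1 r x.
have dt : \sum_i dtau i x ^+ 2 <= 16 * tau x.
  apply: (le_trans (sum_sqr_gradient_cutoff x r0)); rewrite ler_wpM2r //.
  by rewrite ler_piMr // invf_le1 ?exprn_gt0 // exprn_ege1.
(* The two sides differ by a sum of squares. Doubling the inequality gives the constants [2 * M * B]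
   and [64 = 4 * 16]. *)
have young : tau x ^+ 2 * g / 2 * (\sum_i p i x ^+ 2) - 2 * u x ^+ 2 * g * (\sum_i dtau i x ^+ 2)
    - u x * tau x ^+ 2 * g * f (u x) <=
    \sum_i ((p i x * p i x + u x * H i i x) * (tau x * tau x * g) +
      u x * p i x * ((dtau i x * tau x + tau x * dtau i x) * g +
        tau x * tau x * (- x 0 i * g))).
  rewrite u_sol !mulr_sumr -!sumrB; apply: ler_sum => i _.
  rewrite -subr_ge0; set d := (X in 0 <= X).
  have -> : d = g / 2 * (p i x * tau x + 2 * u x * dtau i x) ^+ 2.
    by rewrite /d; field.
  by rewrite mulr_ge0 ?sqr_ge0 // divr_ge0 // ltW.
have u2 : u x ^+ 2 * (\sum_i dtau i x ^+ 2) <= M ^+ 2 * (16 * tau x).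
  apply: ler_pM => //; first exact: sqr_ge0.
    by apply: sumr_ge0 => i _; exact: sqr_ge0.
  by rewrite -real_normK ?num_real // lerXn2r ?nnegrE // (le_trans _ (uM x)).
have uf : u x * f (u x) * tau x ^+ 2 <= M * B * tau x.
  apply: (le_trans (ler_norm _)); rewrite normrM (ger0_norm (sqr_ge0 _)) normrM.
  have yf : `|u x| * `|f (u x)| <= M * B by apply: ler_pM.
  have tt : tau x ^+ 2 <= tau x by rewrite expr2 ler_piMr.
  apply: ler_pM yf tt; [exact: mulr_ge0|exact: sqr_ge0].
have := ler_wpM2r (ltW g0) u2; have := ler_wpM2r (ltW g0) uf.
rewrite -/tau; move: young.
move: (\sum_i p i x ^+ 2) (\sum_i dtau i x ^+ 2) (\sum_i _) (tau x) (f (u x)) (u x) => P D S t v y.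
lra.
Qed.

(* The null part is minus the divergence of [tau gauss x]: it bounds the second
   moment by [n] times the mass, so the mass sits in a fixed box. *)
Lemma mass_estimate (r : R) : 0 < r ->
  exists2 N, grid_null r N & forall x, cutoff r x * gauss x <=
    N x + n.+1%:R * box_indicator (const_mx (- n.+1%:R)) (const_mx n.+1%:R) x.
Proof.
move=> r0.
pose tau := cutoff r : 'rV[R]_n -> R.
pose dtau i (x : 'rV[R]_n) := - 4 * r ^- 2 * hat r x * x 0 i.
have Htau : has_gradient tau dtau := has_gradient_cutoff r.
have HW := has_gradientM Htau (@has_gradient_gauss R n).
have Wr : vanishes_outside r (fun x => tau x * gauss x).
  by apply: vanishes_outsideMl; exact: cutoff_vanishes.
have NW i := null_partial i r0 (has_gradientM (has_gradient_coord i) HW)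
  (vanishes_outsideMr (fun x => x 0 i) Wr).
refine (ex_intro2 _ _ _ (nullZ (-1) (null_sum (index_enum _) NW)) _) => x /=.
have g0 := gauss_gt0 x; have g1 := gauss_le1 x; set g := gauss x in g0 g1 *.
have t0 : 0 <= tau x := cutoff_ge0 r x; have t1 : tau x <= 1 := cutoff_le1 r x.
rewrite -/tau.
have S : \sum_i ((i == i)%:R * (tau x * g) + x 0 i * (dtau i x * g + tau x * (- x 0 i * g)))
   <= tau x * g * (n%:R - sqnorm x).
  have -> : n%:R - sqnorm x = \sum_(i < n) (1 - x 0 i * x 0 i).
    by rewrite sumrB sumr_const card_ord.
  rewrite mulr_sumr; apply: ler_sum => i _; rewrite eqxx mul1r.
  (* The cutoff does not increase away from the origin, so its contribution has a sign. *)
  have : x 0 i * dtau i x * g <= 0.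
    rewrite mulr_le0_ge0 ?(ltW g0) //.
    have -> : x 0 i * dtau i x = - (4 * r ^- 2 * hat r x * x 0 i ^+ 2).
      by rewrite /dtau; ring.
    have /andP[h0 _] := hat_le1 r x.
    rewrite oppr_le0; apply: mulr_ge0 (sqr_ge0 _); apply: mulr_ge0 h0.
    by rewrite mulr_ge0 // invr_ge0 sqr_ge0.
  lra.
have tg : 0 <= tau x * g <= 1.
  by rewrite mulr_ge0 ?(ltW g0) // mulr_ile1 // ltW.
(* One more copy of [tau x * g] turns [n] into [n.+1]. Outside the box [|x|^2] exceeds [n.+1], and
   the left side is nonpositive. *)
suff : tau x * g * (n.+1%:R - sqnorm x) <=
    n.+1%:R * box_indicator (const_mx (- n.+1%:R)) (const_mx n.+1%:R) x.
  have : tau x * g * (n.+1%:R - sqnorm x) = tau x * g * (n%:R - sqnorm x) + tau x * g.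
    by rewrite -natr1; ring.
  lra.
have s0 := sqnorm_ge0 x.
have [xin|xout] := pselect (closed_box (const_mx (- n.+1%:R)) (const_mx n.+1%:R) x).
  rewrite box_indicator_in // mulr1.
  apply: (@le_trans _ _ (tau x * g * n.+1%:R)).
    by rewrite ler_wpM2l ?lerBlDr ?lerDl //; case/andP: tg.
  by rewrite ler_piMl //; case/andP: tg.
rewrite box_indicator_out // mulr0 mulr_ge0_le0 //; first by case/andP: tg.
rewrite subr_le0.
have [i Hi] : exists i, n.+1%:R < `|x 0 i|.
  apply: contrapT => H'; apply: xout => i; rewrite !mxE -ler_norml leNgt.
  by apply/negP => Hi; apply: H'; exists i.
apply: le_trans (sqr_coord_le x i); rewrite -real_normK ?num_real //.
have n1 : 1 <= n.+1%:R :> R by rewrite ler1n.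
move: (`|x 0 i|) n1 Hi => y; nra.
Qed.

End OrnsteinUhlenbeck.

(** * Liouville argument *)

Section Liouville.
Context {R : realType} {n : nat}.
Variables (f F : R -> R) (u : 'rV[R]_n -> R).
Variables (p : 'I_n -> 'rV[R]_n -> R) (H : 'I_n -> 'I_n -> 'rV[R]_n -> R).
Hypothesis Hu : has_gradient u p.
Hypothesis Hp : forall i, has_gradient (p i) (H i).
Hypothesis H_sym : forall i j x, H i j x = H j i x.
Hypothesis u_sol : forall x, f (u x) = \sum_j (x 0 j * p j x - H j j x).
Hypothesis f_cont : continuous f.
Hypothesis F_f : forall x, is_derive (u x) 1 F (f (u x)).
Variables (M B : R).
Hypothesis uM : forall x, `|u x| <= M.
Hypothesis fB : forall x, `|f (u x)| <= B.
Variable w : 'rV[R]_n.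

Let phi x := \sum_k w 0 k * p k x.
Let dphi j x := \sum_k w 0 k * H k j x.

Hypothesis phi_gt0 : forall x, 0 < phi x.
Implicit Types (i j k : 'I_n) (x : 'rV[R]_n).

Let sigma i x := p i x * (phi x)^-1.
Let dsigma i j x := H i j x * (phi x)^-1 + p i x * (- (phi x) ^- 2 * dphi j x).

Let Hphi : has_gradient phi dphi.
Proof.
exact: (has_gradient_sum (index_enum _) (fun k => has_gradientZ (w 0 k) (Hp k))).
Qed.

Let Hsigma i : has_gradient (sigma i) (dsigma i).
Proof.
apply: has_gradientM => //; apply: has_gradientV => // x.
by rewrite gt_eqF.
Qed.

(** [phi^2 grad (p i / phi) = phi grad (p i) - p i grad phi] is the combination, with weights
    [w 0 k], of the fluxes in [linearized_equation]. *)
Let weighted_equation r i psi dpsi : 0 < r ->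
  has_gradient psi dpsi -> vanishes_outside r psi ->
  grid_null r (fun x => gauss x * phi x ^+ 2 * \sum_j dsigma i j x * dpsi j x).
Proof.
move=> r0 Hpsi psir.
have N k := nullZ (w 0 k)
  (linearized_equation Hu Hp H_sym u_sol i k f_cont F_f r0 Hpsi psir).
apply: null_ext (null_sum (index_enum _) N) => x /=.
rewrite -mulrA [in RHS]mulr_sumr [in RHS]mulr_sumr.
under eq_bigr => k _.
  rewrite !mulr_sumr; over.
rewrite exchange_big /=; apply: eq_bigr => j _.
have phi0 : phi x != 0 by rewrite gt_eqF.
have -> : phi x ^+ 2 * (dsigma i j x * dpsi j x) =
    (phi x * H i j x - p i x * dphi j x) * dpsi j x.
  by rewrite /dsigma; field.
rewrite /phi /dphi [p i x * _]mulr_sumr mulr_suml -sumrB mulr_suml mulr_sumr.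
by apply: eq_bigr => k _; ring.
Qed.

(** With test function [tau^3 sigma], Young's inequality leaves the error
    [tau sigma^2 |grad tau|^2], at most [16 r^-2 tau^2 sigma^2]; then [phi sigma = p i] gives the
    energy with weight [tau^2]. The constant is [2 * 9/2 * 16]. *)
Let quotient_energy i r : 1 <= r -> exists2 N, grid_null r N & forall x,
  gauss x * phi x ^+ 2 * cutoff r x ^+ 3 * (\sum_j dsigma i j x ^+ 2) <=
  N x + 144 * r ^- 2 * (cutoff r x ^+ 2 * gauss x * \sum_j p j x ^+ 2).
Proof.
move=> r1; have r0 : 0 < r by rewrite (lt_le_trans ltr01).
pose tau := cutoff r : 'rV[R]_n -> R.
pose dtau j (x : 'rV[R]_n) := - 4 * r ^- 2 * hat r x * x 0 j.
have Htau : has_gradient tau dtau := has_gradient_cutoff r.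
have Hpsi := has_gradientM (has_gradientM Htau (has_gradientM Htau Htau)) (Hsigma i).
have psir : vanishes_outside r (fun x => tau x * (tau x * tau x) * sigma i x).
  by apply: vanishes_outsideMl; apply: vanishes_outsideMl; exact: cutoff_vanishes.
refine (ex_intro2 _ _ _ (nullZ 2 (weighted_equation i r0 Hpsi psir)) _) => x /=.
have g0 := gauss_gt0 x.
have t0 : 0 <= tau x := cutoff_ge0 r x.
have dt : \sum_j dtau j x ^+ 2 <= 16 * r ^- 2 * tau x := sum_sqr_gradient_cutoff x r0.
have young : tau x ^+ 3 / 2 * (\sum_j dsigma i j x ^+ 2)
     - 9 / 2 * tau x * sigma i x ^+ 2 * (\sum_j dtau j x ^+ 2) <=
   \sum_j dsigma i j x * ((dtau j x * (tau x * tau x)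
        + tau x * (dtau j x * tau x + tau x * dtau j x)) * sigma i x
      + tau x * (tau x * tau x) * dsigma i j x).
  rewrite !mulr_sumr -sumrB; apply: ler_sum => j _.
  rewrite -subr_ge0; set d := (X in 0 <= X).
  have -> : d = tau x / 2 * (tau x * dsigma i j x + 3 * dtau j x * sigma i x) ^+ 2.
    by rewrite /d; move: (dsigma i j x) (dtau j x) (tau x) (sigma i x) => *; field.
  by rewrite mulr_ge0 ?sqr_ge0 // divr_ge0.
have psum : phi x ^+ 2 * sigma i x ^+ 2 <= \sum_j p j x ^+ 2.
  rewrite -exprMn /sigma mulrCA divff ?gt_eqF // mulr1 (bigD1 i) //= lerDl.
  by apply: sumr_ge0 => j _; exact: sqr_ge0.
have ri : 0 <= r ^- 2 by rewrite invr_ge0 sqr_ge0.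
rewrite -/tau; move: (\sum_j p j x ^+ 2) psum => P psum.
have G : 0 <= gauss x * phi x ^+ 2 by rewrite mulr_ge0 ?sqr_ge0 // ltW.
have := ler_wpM2l G young.
have s2 : 0 <= tau x * sigma i x ^+ 2 by rewrite mulr_ge0 ?sqr_ge0.
have := ler_wpM2l (mulr_ge0 G s2) dt.
have tr : 0 <= gauss x * (r ^- 2 * tau x ^+ 2).
  by rewrite mulr_ge0 ?(ltW g0) // mulr_ge0 // sqr_ge0.
have := ler_wpM2l tr psum.
move: (\sum_j dsigma i j x ^+ 2) (\sum_j dtau j x ^+ 2) (\sum_j _) => D T S.
move: (gauss x) (phi x) (tau x) (sigma i x) (r ^- 2) => g y t s q.
lra.
Qed.

Let K := 144 * (2 * M * B + 64 * M ^+ 2) * n.+1%:R.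

(** The three estimates are chained. Neither [K] nor the box depends on [r], so up to a null part
    the bound decays like [r ^- 2]. *)
Let quotient_energy_box i r : 1 <= r -> exists2 N, grid_null r N & forall x,
  gauss x * phi x ^+ 2 * cutoff r x ^+ 3 * (\sum_j dsigma i j x ^+ 2) <=
  N x + K * r ^- 2 * box_indicator (const_mx (- n.+1%:R)) (const_mx n.+1%:R) x.
Proof.
move=> r1; have r0 : 0 < r by rewrite (lt_le_trans ltr01).
have [N1 N1r le1] := quotient_energy i r1.
have [N2 N2r le2] := energy_estimate Hu Hp u_sol r1 uM fB.
have [N3 N3r le3] := @mass_estimate R n r r0.
pose A := 2 * M * B + 64 * M ^+ 2.
have A0 : 0 <= A.
  have M0 : 0 <= M := le_trans (normr_ge0 _) (uM 0).
  have B0 : 0 <= B := le_trans (normr_ge0 _) (fB 0).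
  by rewrite addr_ge0 ?mulr_ge0 ?sqr_ge0.
have q0 : 0 <= 144 * r ^- 2 by rewrite mulr_ge0 // invr_ge0 sqr_ge0.
refine (ex_intro2 _ _ _ (nullD N1r (nullZ (144 * r ^- 2) (nullD N2r (nullZ A N3r)))) _).
move=> x /=; apply: (le_trans (le1 x)).
have := ler_wpM2l q0 (le_trans (le2 x) (lerD (lexx (N2 x)) (ler_wpM2l A0 (le3 x)))).
rewrite /K -/A; lra.
Qed.

(** A nonzero value at [x] would bound the weighted energy near [x] from below independently of [r],
    against the decay in [r ^- 2]. *)
Let quotient_gradient_eq0 i j x : dsigma i j x = 0.
Proof.
apply/eqP/negPn/negP => dx.
pose Y (y : 'rV[R]_n) := gauss y * phi y ^+ 2 * dsigma i j y ^+ 2.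
have Y_ge0 y : 0 <= Y y.
  by rewrite mulr_ge0 ?sqr_ge0 // mulr_ge0 ?sqr_ge0 // ltW // gauss_gt0.
have Yx : 0 < Y x.
  rewrite mulr_gt0 ?exprn_even_gt0 // mulr_gt0 ?exprn_gt0 //; exact: gauss_gt0.
pose c := Y x / 2; have c0 : 0 < c by rewrite divr_gt0.
have : \forall y \near x, c < Y y.
  have contY : Y y @[y --> x] --> Y x.
    rewrite /Y !expr2; under eq_fun do rewrite !expr2.
    have cs : dsigma i j y @[y --> x] --> dsigma i j x := ((Hsigma i).2 j).2 x.
    have cp : phi y @[y --> x] --> phi x := Hphi.1 x.
    have cg : gauss y @[y --> x] --> gauss x := has_gradient_gauss.1 x.
    exact: cvgM (cvgM cg (cvgM cp cp)) (cvgM cs cs).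
  have cY : c < Y x by rewrite ltr_pdivrMr // ltr_pMr // ltr1n.
  by move: contY => /cvgr_gt; apply.
move=> /nbhs_ballP[d d0 dP]; have {}d0 : 0 < d := d0.
have d20 : 0 < d / 2 by rewrite divr_gt0.
pose a := x - const_mx (d / 2); pose b := x + const_mx (d / 2).
have box_c y : closed_box a b y -> c < Y y.
  move=> yab; apply: dP; split => // i' k; rewrite ord1.
  have := yab k; rewrite !mxE => /andP[? ?].
  rewrite /ball /= ltr_norml; lra.
pose S := \sum_k (`|x 0 k| + d) ^+ 2.
have S0 : 0 <= S by apply: sumr_ge0 => k _; exact: sqr_ge0.
have box_S y : closed_box a b y -> sqnorm y <= S.
  move=> yab; apply: ler_sum => k _; rewrite -expr2.
  rewrite -[leLHS]real_normK ?num_real //.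
  apply: lerXn2r; rewrite ?nnegrE ?(addr_ge0 _ (ltW d0)) //.
  have := yab k; rewrite !mxE => /andP[? ?].
  have := ler_norm (x 0 k); have := ler_norm (- x 0 k); rewrite normrN => ? ?.
  by rewrite ler_norml; apply/andP; split; lra.
(* Bounds the grid sum over the fixed box, of side [2 * n.+1], once the mesh is below [1]. *)
pose D := (n.+1%:R *+ 2 + 1 : R) ^+ n.
have D0 : 0 <= D by rewrite exprn_ge0 // addr_ge0.
(* [64] comes from the cube of the cutoff, itself at least [1/4]; the box has side [d], and counting
   loses one mesh, below [d / 2]. *)
pose K' := c / 64 * (d / 2) ^+ n.
have K'0 : 0 < K' by rewrite mulr_gt0 ?exprn_gt0 // divr_gt0.
pose L := `|K| * D; have L0 : 0 <= L by rewrite mulr_ge0.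
pose X1 := \sum_k `|x 0 k|; have X10 : 0 <= X1 by exact: sumr_ge0.
have LK : 0 <= 2 * L / K' by apply: divr_ge0; [exact: mulr_ge0|exact: ltW].
(* [d + X1] puts the box inside the grid cube, [2 * S] makes [hat] at least [1/2] on the box, and
   [2 * L / K'] brings the decaying term down to [K' / 2]. *)
pose r := 1 + d + X1 + 2 * S + 2 * L / K'.
have r1 : 1 <= r by rewrite /r; lra.
have r0 : 0 < r by lra.
have rr : r <= r ^+ 2 by rewrite expr2 ler_peMl // ltW.
have xr k : `|x 0 k| + d <= r.
  have : `|x 0 k| <= X1 by rewrite /X1 (bigD1 k) //= lerDl sumr_ge0.
  rewrite /r; lra.
have box_cutoff y : closed_box a b y -> 4^-1 <= cutoff r y.
  move=> /box_S yS; have -> : 4^-1 = 2^-1 ^+ 2 :> R by rewrite exprVn -natrX.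
  apply: lerXn2r; rewrite ?nnegrE ?invr_ge0 //; first by have /andP[] := hat_le1 r y.
  rewrite /hat le_max; apply/orP; right.
  have : r ^- 2 * sqnorm y <= 2^-1.
    rewrite mulrC ler_pdivrMr ?exprn_gt0 //.
    have : 2 * S <= r by rewrite /r; lra.
    lra.
  lra.
have [N Nr le_N] := quotient_energy_box i r1.
pose I (y : 'rV[R]_n) := box_indicator (const_mx (- n.+1%:R)) (const_mx n.+1%:R) y.
have pointwise y : c / 64 * box_indicator a b y <= N y + K * r ^- 2 * I y.
  apply: le_trans (le_N y).
  have YS : Y y * cutoff r y ^+ 3 <=
      gauss y * phi y ^+ 2 * cutoff r y ^+ 3 * \sum_k dsigma i k y ^+ 2.
    rewrite /Y mulrAC; apply: ler_wpM2l.
      apply: mulr_ge0; last by rewrite exprn_ge0 // cutoff_ge0.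
      by apply: mulr_ge0; [exact/ltW/gauss_gt0|exact: sqr_ge0].
    by rewrite (bigD1 j) //= lerDl; apply: sumr_ge0 => k _; exact: sqr_ge0.
  apply: le_trans YS.
  have [yab|yab] := pselect (closed_box a b y); last first.
    by rewrite box_indicator_out // mulr0 mulr_ge0 // exprn_ge0 // cutoff_ge0.
  rewrite box_indicator_in // mulr1; apply: ler_pM; rewrite ?invr_ge0 ?(ltW c0) //.
    exact/ltW/box_c.
  have -> : 64^-1 = 4^-1 ^+ 3 :> R by rewrite exprVn -natrX.
  by apply: lerXn2r; rewrite ?nnegrE ?cutoff_ge0 ?invr_ge0 // box_cutoff.
(* With [r] fixed, the mesh is refined until the null part falls below the other half of [K']. *)
have [m [md m1 mN]] : exists m, [/\ mesh r m < d / 2, mesh r m < 1 & grid_sum r m N < K' / 2].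
  have K'20 : 0 < K' / 2 by rewrite divr_gt0.
  have nN : \forall m \near \oo, grid_sum r m N < K' / 2 by have /cvgr_lt := Nr; apply.
  have [m0 _ m0P] := filterI (filterI (mesh_lt r d20) (mesh_lt r ltr01)) nN.
  by exists m0; have [[? ?] ?] := m0P m0 (leqnn m0); split.
have := @grid_sum_le _ _ r m _ _ r0 (fun y _ => pointwise y).
rewrite grid_sumZ grid_sumD grid_sumZ.
have lower : (d / 2) ^+ n <= grid_sum r m (box_indicator a b).
  apply: (le_trans _ (grid_sum_box_ge r0 _ _ _)).
  - rewrite -[X in _ ^+ X](card_ord n) -prodr_const; apply: ler_prod => k _.
    by rewrite !mxE ltW //=; lra.
  - by move=> k; rewrite !mxE; lra.
  - by move=> k; rewrite !mxE; have := xr k; have := ler_norm (- x 0 k); rewrite normrN; lra.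
  - by move=> k; rewrite !mxE; have := xr k; have := ler_norm (x 0 k); lra.
have upper : grid_sum r m I <= D.
  have n0 : 0 <= n.+1%:R :> R by exact: ler0n.
  apply: (le_trans (grid_sum_box_le _ r0 _)); first by move=> k; rewrite !mxE; lra.
  rewrite /D -[X in _ ^+ X](card_ord n) -prodr_const; apply: ler_prod => k _.
  by rewrite !mxE; have := mesh_gt0 m r0; rewrite mulr2n; lra.
have I0 : 0 <= grid_sum r m I.
  have := @grid_sum_le _ _ r m (fun=> 0) I r0 (fun y _ => box_indicator_ge0 _ _ y).
  by rewrite grid_sum_cst mulr0.
apply/negP; rewrite -ltNge.
have KI : K * r ^- 2 * grid_sum r m I <= K' / 2.
  apply: (@le_trans _ _ (L * r ^- 2)).
    rewrite /L [leLHS]mulrAC; apply: ler_wpM2r; first by rewrite invr_ge0 sqr_ge0.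
    by apply: (le_trans (ler_norm _)); rewrite normrM ler_wpM2l // ger0_norm.
  rewrite ler_pdivrMr ?exprn_gt0 //.
  have : 2 * L / K' <= r ^+ 2 by apply: le_trans rr; rewrite /r; lra.
  rewrite ler_pdivrMr //; lra.
apply: (@lt_le_trans _ _ K'); last by rewrite ler_wpM2l // divr_ge0 // ltW.
by rewrite [K']splitr ltr_leD.
Qed.

(** The zero gradient of [sigma i] is orthogonal to the displacement from [0] to [x], so [sigma i]
    keeps its value at the origin. *)
Lemma gradient_ratio i x : p i x = p i 0 / phi 0 * phi x.
Proof.
have := @constant_of_orthogonal_gradient _ _ _ _ 0 x (Hsigma i).
rewrite addr0 -/(sigma i 0) => <-; first by rewrite /sigma divfK // gt_eqF.
by move=> y; rewrite big1 // => j _; rewrite quotient_gradient_eq0 mulr0.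
Qed.

End Liouville.

(** * Constancy on the hyperplanes orthogonal to a fixed direction *)

Theorem theorem1p1 (R : realType) (n : nat) (f : R -> R)
    (f_lip : locally_lipschitz f)
    (u : 'rV[R]_n -> R) (u_C2 : C2 u) (u_Linfty : ess_bounded u)
    (u_sol : forall x : 'rV[R]_n,
       laplacian u x - inner x (gradient u x) + f (u x) = 0)
    (u_mono : exists w : 'rV[R]_n,
       forall x : 'rV[R]_n, 0 < inner (gradient u x) w) :
  exists (U : R -> R) (omega : 'rV[R]_n),
    forall x : 'rV[R]_n, u x = U (inner omega x).
Proof.
have [w u_w] := u_mono.
have Hu := C1_has_gradient u_C2.1.
have Hp i := C1_has_gradient (u_C2.2 i).
have H_sym i j x : partial j (partial i u) x = partial i (partial j u) x.
  exact: partial_sym.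
have f_cont := locally_lipschitz_continuous f_lip.
have [M uM] := ess_bounded_continuous Hu.1 u_Linfty.
have [F F_f] := bounded_antiderivative M f_cont.
have [B fB] := continuous_bounded_on_segment M f_cont.
have u_eq x : f (u x) = \sum_j (x 0 j * partial j u x - partial j (partial j u) x).
  rewrite sumrB; have := u_sol x; rewrite /laplacian /inner.
  under [X in _ - X]eq_bigr do rewrite mxE.
  move: (\sum_j _) (\sum_i _) (f (u x)) => a b c; lra.
have phi_gt0 x : 0 < \sum_k w 0 k * partial k u x.
  have := u_w x; rewrite /inner; under eq_bigr do rewrite mxE mulrC; exact.
have ratio := gradient_ratio Hu Hp H_sym u_eq f_cont (fun x => F_f _ (uM x))
  uM (fun x => fB _ (uM x)) phi_gt0.
(* With this vector, [ratio] says that [grad u] is [<grad u, w>] times [omega] at every point. *)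
pose omega : 'rV[R]_n :=
  \row_i (partial i u 0 / \sum_k w 0 k * partial k u 0).
(* [U s] is the value of [u] at a chosen point of the level set of [inner omega]; if [s] is not
   attained, [get] returns a default point, and such an [s] never equals [inner omega x]. *)
exists (fun s => u (get [set x | inner omega x = s])), omega => x.
have : inner omega (get [set y | inner omega y = inner omega x]) = inner omega x.
  exact: (@getPex _ [set y | inner omega y = inner omega x] (ex_intro _ x erefl)).
move: (get _) => y yx.
(* [x - y] is orthogonal to [omega], hence to the gradient of [u] at every point. *)
have := @constant_of_orthogonal_gradient _ _ _ _ y (x - y) Hu.
rewrite subrK; apply => z.
under eq_bigr => i _ do rewrite ratio mulrA.
rewrite -mulr_suml (_ : \sum_i _ = 0) ?mul0r //.
transitivity (inner omega x - inner omega y); last by rewrite yx subrr.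
by rewrite /inner -sumrB; apply: eq_bigr => i _; rewrite !mxE; ring.
Qed.
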